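(* Let $\mu=(\mu_1,\dots,\mu_{\ell(\mu)})$ be a partition. Then $$b_\mu^{\,|\mu|-\ell(\mu)+1} = \mathfrak{A}_{(\mu_1-1,\ \mu_2-1,\ \dots,\ \mu_{\ell(\mu)}-1)} .$$
   Context: A partition $\mu$ of $n$ (written $\mu\vdash n$) is a non-increasing finite sequence of positive integers (parts) with sum $n=|\mu|$; $\ell(\mu)$ is its number of parts. Definition of $b^k_\mu$. View $S_{2n}$ as the group of permutations of $\{1,\bar 1,\dots,n,\bar n\}$, with the convention $\overline{\bar i}=i$. The hyperoctahedral group $H_n\subset S_{2n}$ consists of the $\sigma$ with $\overline{\sigma(i)}=\sigma(\bar i)$ for all $i$. Put $p_n=\sum_{h\in H_n}h$. For $\sigma\in S_{2n}$, let $G_\sigma$ be the (multi)graph on vertex set $\{1,\bar1,\dots,n,\bar n\}$ with a solid edge between $i$ and $\bar i$ and a dashed edge between $\sigma(i)$ and $\sigma(\bar i)$ for each $i=1,\dots,n$. It is a disjoint union of cycles of even lengths $2\mu_1\ge 2\mu_2\ge\cdots$ (a solid and a dashed edge with the same endpoints form a cycle of length 2); the partition $\mu=(\mu_1,\mu_2,\dots)\vdash n$ is the coset-type of $\sigma$. Let $\mathcal{C}^{(2)}_\mu$ be the sum of all $\sigma\in S_{2n}$ of coset-type $\mu$. With the order $1<\bar1<2<\bar2<\cdots<n<\bar n$, put $$J^{(2)}_i=\sum_{j=1,\bar1,\dots,i-1,\overline{i-1}}(j\ i),\qquad 1\le i\le n .$$ These elements commute, and for every symmetric function $F$ the element $F(J^{(2)}_1,\dots,J^{(2)}_n)\,p_n$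 is a linear combination of the $\mathcal{C}^{(2)}_\mu$, $\mu\vdash n$. With $h_k$ the complete homogeneous symmetric function of degree $k$ ($h_0=1$), the coefficients $b^k_\mu$ are defined by $$h_k(J^{(2)}_1,\dots,J^{(2)}_n)\,p_n=\sum_{\mu\vdash n}b^k_\mu\,\mathcal{C}^{(2)}_\mu .$$ Definition of $\mathfrak{A}_I$. A Dyck path of length $2k$ is a lattice path with $2k$ steps $(1,1)$ and $(1,-1)$, from $(0,0)$ to $(2k,0)$, never going below the $x$-axis. The area under a Dyck path is the Euclidean area of the region between the path and the $x$-axis. A weak composition is a finite sequence of non-negative integers. For a weak composition $I=(i_1,\dots,i_r)$, let $\mathcal{P}_I$ be the set of Dyck paths of length $2(i_1+\dots+i_r)$ whose height after $2i_1$, $2(i_1+i_2)$, $\dots$ steps is zero (that is, concatenations of Dyck paths of lengths $2i_1,2i_2,\dots,2i_r$). Then $\mathfrak{A}_I$ is the sum, over all paths in $\mathcal{P}_I$, of the area under the path. *)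

(* Defs.v *)
From HB Require Import structures.
From mathcomp Require Import all_boot all_order all_fingroup all_algebra.

Set Implicit Arguments.
Unset Strict Implicit.
Unset Printing Implicit Defensive.

Import Order.TTheory GRing.Theory Num.Theory.
Local Open Scope ring_scope.

Definition is_partition (n : nat) (s : seq nat) : bool :=
  [&& sorted geq s, 0%N \notin s & sumn s == n].

Record intpartn (n : nat) := IntPartn {
  partval :> seq nat;
  partvalP : is_partition n partval }.

HB.instance Definition _ n := [isSub for @partval n].
HB.instance Definition _ n := [Countable of intpartn n by <:].

Lemma size_le_sumn (s : seq nat) : 0%N \notin s -> (size s <= sumn s)%N.
Proof.
elim: s => //= x s IHs; rewrite inE negb_or eq_sym -lt0n => /andP[x_gt0 /IHs].
by rewrite -add1n; apply: leq_add.
Qed.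

Lemma mem_le_sumn (s : seq nat) (x : nat) : x \in s -> (x <= sumn s)%N.
Proof.
elim: s => //= y s IHs; rewrite inE => /orP[/eqP->|/IHs le_x].
  exact: leq_addr.
exact: leq_trans le_x (leq_addl _ _).
Qed.

Definition intpartn_code (n : nat) (mu : intpartn n) : n.-bseq 'I_n.+1 :=
  insub_bseq n [seq inord m | m <- mu].

Definition intpartn_decode (n : nat) (s : n.-bseq 'I_n.+1) :
    option (intpartn n) :=
  insub [seq val i | i <- s].

Lemma intpartn_codeK n : pcancel (@intpartn_code n) (@intpartn_decode n).
Proof.
move=> mu; rewrite /intpartn_decode /intpartn_code.
have /and3P[_ mu_pos /eqP sum_mu] := partvalP mu.
have size_mu : (size [seq inord m : 'I_n.+1 | m <- mu] <= n)%N.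
  by rewrite size_map -[leqRHS]sum_mu size_le_sumn.
rewrite /insub_bseq insubdK // -map_comp.
have -> : [seq (val \o (inord : nat -> 'I_n.+1)) m | m <- mu] = mu.
  rewrite -[RHS]map_id; apply/eq_in_map => m mu_m /=.
  by rewrite inordK // ltnS -sum_mu mem_le_sumn.
exact: valK.
Qed.

HB.instance Definition _ n :=
  isFinite.Build (intpartn n) (pcan_enumP (@intpartn_codeK n)).

(* [f] stands for the formal sum of the [f s] s.  Permutations are multiplied
   as functions, [s t = s \o t], whereas [(s * t)%g] is [t \o s]; hence the
   order of the factors in [permalg_mul] and in [permalg_ofM].  The alias hides
   the pointwise product of {ffun _ -> _}. *)
Definition permalg (T : finType) : Type := {ffun {perm T} -> rat^o}.

Section PermAlg.
Variable T : finType.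
Implicit Types (f g h : permalg T) (s t : {perm T}).

HB.instance Definition _ := Vector.on (permalg T).

Definition permalg_of s : permalg T := [ffun t => (t == s)%:R].

Definition permalg_mul f g : permalg T :=
  [ffun s => \sum_(t : {perm T}) f t * g (s * t^-1)%g].

Fact permalg_mulA : associative permalg_mul.
Proof.
move=> f g h; apply/ffunP=> s; rewrite !ffunE.
under eq_bigr => t _ do rewrite ffunE mulr_sumr.
under [RHS]eq_bigr => t _ do rewrite ffunE mulr_suml.
rewrite [RHS]exchange_big /=; apply: eq_bigr => t _.
rewrite [RHS](reindex_inj (mulIg t)) /=; apply: eq_bigr => u _.
by rewrite mulgK invMg !mulgA mulrA.
Qed.

Fact permalg_mul1 : left_id (permalg_of 1%g) permalg_mul.
Proof.
move=> f; apply/ffunP=> s; rewrite !ffunE (bigD1 1%g) //= ffunE eqxx mul1r.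
by rewrite invg1 mulg1 big1 ?addr0 // => t /negPf t1; rewrite ffunE t1 mul0r.
Qed.

Fact permalg_mulr1 : right_id (permalg_of 1%g) permalg_mul.
Proof.
move=> f; apply/ffunP=> s; rewrite !ffunE (bigD1 s) //= ffunE mulgV eqxx mulr1.
rewrite big1 ?addr0 // => t t_s; rewrite ffunE -eq_mulgV1 eq_sym (negPf t_s).
by rewrite mulr0.
Qed.

Fact permalg_mulDl : left_distributive permalg_mul +%R.
Proof.
move=> f g h; apply/ffunP=> s; rewrite !ffunE -big_split /=.
by apply: eq_bigr => t _; rewrite ffunE mulrDl.
Qed.

Fact permalg_mulDr : right_distributive permalg_mul +%R.
Proof.
move=> f g h; apply/ffunP=> s; rewrite !ffunE -big_split /=.
by apply: eq_bigr => t _; rewrite ffunE mulrDr.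
Qed.

Fact permalg_1neq0 : permalg_of 1%g != 0.
Proof.
by apply/eqP => /ffunP/(_ 1%g); rewrite !ffunE eqxx => /eqP; rewrite oner_eq0.
Qed.

HB.instance Definition _ := GRing.Zmodule_isNzRing.Build (permalg T)
  permalg_mulA permalg_mul1 permalg_mulr1 permalg_mulDl permalg_mulDr
  permalg_1neq0.

Lemma permalg_ofM s t :
  permalg_of s * permalg_of t = permalg_of (t * s)%g :> permalg T.
Proof.
apply/ffunP=> u; rewrite !ffunE (bigD1 s) //= !ffunE eqxx mul1r big1 ?addr0.
  by rewrite -(inj_eq (mulIg s)) mulgKV.
by move=> v /negPf v_s; rewrite ffunE v_s mul0r.
Qed.

End PermAlg.

(* For commuting [x i] the order of the factors is immaterial. *)
Definition complete_homogeneous (R : nzRingType) (n k : nat)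
    (x : 'I_n -> R) : R :=
  \sum_(t : k.-tuple 'I_n | sorted leq [seq val i | i <- t])
     \prod_(i <- t) x i.

(* The set {1, 1bar, ..., n, nbar}: [(i, false)] is i+1 and [(i, true)] is
   its barred copy. *)
Definition bpoint (n : nat) : finType := ('I_n * bool)%type.

Definition bar (n : nat) (x : bpoint n) : bpoint n := (x.1, ~~ x.2).

Definition hyperoctahedral (n : nat) : {set {perm bpoint n}} :=
  [set s : {perm bpoint n} | [forall x : bpoint n, bar (s x) == s (bar x)]].

Definition hyperoctahedral_sum (n : nat) : permalg (bpoint n) :=
  \sum_(s in hyperoctahedral n) permalg_of s.

Definition solid_edge (n : nat) : rel (bpoint n) :=
  fun x y => [exists z : bpoint n, (x == z) && (y == bar z)].

Definition dashed_edge (n : nat) (s : {perm bpoint n}) : rel (bpoint n) :=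
  fun x y => [exists z : bpoint n, (x == s z) && (y == s (bar z))].

Definition coset_graph (n : nat) (s : {perm bpoint n}) : rel (bpoint n) :=
  fun x y => solid_edge x y || dashed_edge s x y.

Definition cycle_supports (n : nat) (s : {perm bpoint n}) :
    {set {set bpoint n}} :=
  equivalence_partition (connect (coset_graph s)) [set: bpoint n].

(* The length of a cycle is its number of vertices; this also holds for a
   cycle made of two parallel edges, which a relation does not distinguish. *)
Definition coset_type (n : nat) (s : {perm bpoint n}) : seq nat :=
  sort geq [seq #|C|./2 | C : {set bpoint n} in cycle_supports s].

Definition coset_class (n : nat) (mu : intpartn n) : permalg (bpoint n) :=
  \sum_(s : {perm bpoint n} | coset_type s == mu) permalg_of s.

Definition odd_jm (n : nat) (i : 'I_n) : permalg (bpoint n) :=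
  \sum_(j : bpoint n | (j.1 < i)%N) permalg_of (tperm j (i, false)).

Definition coset_class_family (n : nat) :
    #|{: intpartn n}|.-tuple (permalg (bpoint n)) :=
  [tuple coset_class (enum_val p) | p < #|{: intpartn n}|].

(* The coefficient of [coset_class mu] in the expansion of
   h_k(J_1, ..., J_n) p_n as a linear combination of the [coset_class nu];
   these are linearly independent, being sums over disjoint nonempty sets. *)
Definition bcoef (n k : nat) (mu : intpartn n) : rat :=
  coord (coset_class_family n) (enum_rank mu)
    (complete_homogeneous k (@odd_jm n) * hyperoctahedral_sum n).

(* A path is its sequence of steps, [true] for (1, 1) and [false] for
   (1, -1). *)
Definition height (w : seq bool) (j : nat) : int :=
  \sum_(b <- take j w) (if b then 1 else -1).

Definition is_dyck (w : seq bool) : bool :=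
  (height w (size w) == 0) && [forall j : 'I_(size w).+1, 0 <= height w j].

(* Exact area under a nonnegative path: the region under the j-th step is a
   trapezoid of width 1. *)
Definition path_area (w : seq bool) : rat :=
  \sum_(0 <= j < size w) (height w j + height w j.+1)%:~R / 2.

Definition touching_dyck_paths (I : seq nat) :
    {set (2 * sumn I).-tuple bool} :=
  [set w : (2 * sumn I).-tuple bool | is_dyck w &&
     [forall r : 'I_(size I).+1, height w (2 * sumn (take r I))%N == 0]].

Definition dyck_area_sum (I : seq nat) : rat :=
  \sum_(w in touching_dyck_paths I) path_area w.

(* Main.v *)
Require Import Defs.
From mathcomp Require Import all_boot all_order all_fingroup all_algebra.
From mathcomp Require Import zify ring.

(* Evaluated at a permutation s, h_k(J_1, ..., J_n) p_n counts the monotone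
   factorizations carrying the solid matching to the dashed matching of G_s.
   Splitting off the factors (j n) on the left gives a recursion in which a
   transposition either cuts the cycle through n (once for each ordered pair of
   lengths), or leaves the coset type unchanged (m - 1 times for a cycle of
   length 2m), or joins two cycles.  Let r = k - (n - l), where l is the number
   of cycles.  The coefficient vanishes for r < 0, because a transposition
   changes l by at most 1; joining lowers r by 2, so for r <= 1 the joins do not
   contribute.  For r = 0 the recursion is that of products of Catalan numbers,
   and for r = 1 it is the first-return recursion of the area of Dyck paths,
   where the unchanged types supply the area under the first arch.

   The coefficients b are only well defined once h_k(J) p_n is known to be
   constant on coset types.  Each matching has a unique strictly monotone
   factorization, so that e_k(J) p_n is left H_n-invariant; the relation between
   the e_j and the h_k transfers the invariance to h_k(J) p_n.  By the recursion
   the coefficient depends only on the coset type and on the length of the cycle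
   through n, and by invariance any cycle can be moved to n. *)

Set Implicit Arguments.
Unset Strict Implicit.
Unset Printing Implicit Defensive.

Import Order.TTheory GRing.Theory Num.Theory.
Local Open Scope ring_scope.

(** * Orbits of a permutation multiplied by a transposition *)

Section PorbitTperm.
Variable T : finType.
Implicit Types (s : {perm T}) (x y z : T).
Local Open Scope group_scope.

Lemma porbit_iter s x i : iter i s x \in porbit s x.
Proof. by rewrite -permX mem_porbit. Qed.

Lemma porbit_iterP s x y : reflect (exists i, y = iter i s x) (y \in porbit s x).
Proof.
apply: (iffP (porbitP _ _ _)) => -[i ->]; exists i; by rewrite permX.
Qed.

Arguments porbit_iterP {s x y}.

Lemma porbit_iter_lt s x y :
  y \in porbit s x -> exists2 i, (i < #|porbit s x|)%N & y = iter i s x.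
Proof. by rewrite porbit_traject => /trajectP. Qed.

Lemma iter_porbit_inj s x i j : (i < #|porbit s x|)%N ->
  (j < #|porbit s x|)%N -> iter i s x = iter j s x -> i = j.
Proof.
move=> lti ltj eq_ij; have := uniq_traject_porbit s x.
move/(uniqP x)/(_ i j); rewrite !inE size_traject => /(_ lti ltj).
by rewrite !nth_traject //; apply.
Qed.

Lemma porbit_gt0 s x : (0 < #|porbit s x|)%N.
Proof. by apply/card_gt0P; exists x; apply: porbit_id. Qed.

Lemma card_porbit_iter s x i : (0 < i)%N -> iter i s x = x ->
  (forall k, (0 < k < i)%N -> iter k s x != x) -> #|porbit s x| = i.
Proof.
move=> i_gt0 fix_i min_i; have m_gt0 : (0 < #|porbit s x|)%N by apply: porbit_gt0.
case: (ltngtP #|porbit s x| i) => // lt.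
  by have := min_i #|porbit s x|; rewrite m_gt0 lt iter_porbit eqxx => /(_ isT).
have := @iter_porbit_inj s x i 0 lt; rewrite m_gt0 fix_i.
by move=> /(_ isT erefl) i0; rewrite i0 in i_gt0.
Qed.

Lemma porbit_closed s x y : y \in porbit s x -> s y \in porbit s x.
Proof. by case/porbit_iterP=> i ->; rewrite -iterS porbit_iter. Qed.

Lemma porbit_mem_eq s x y : y \in porbit s x -> porbit s y = porbit s x.
Proof. by rewrite -eq_porbit_mem => /eqP. Qed.

Lemma porbit_tperm_other s x y z : z \notin porbit s x -> z \notin porbit s y ->
  porbit (s * tperm x y) z = porbit s z.
Proof.
move=> zx zy.
have E i : iter i (s * tperm x y) z = iter i s z.
  elim: i => //= i ->; rewrite permM -iterS tpermD //; apply/eqP => E.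
    by case/negP: zx; rewrite E porbit_sym porbit_iter.
  by case/negP: zy; rewrite E porbit_sym porbit_iter.
by apply/setP=> u; apply/porbit_iterP/porbit_iterP => -[i ->]; exists i; rewrite E.
Qed.

Lemma porbit_tperm_sub s x y z : y \in porbit s x -> z \in porbit s x ->
  porbit (s * tperm x y) z \subset porbit s x.
Proof.
move=> yx zx; apply/subsetP => u /porbit_iterP[i ->] {u}.
elim: i => //= i IH; rewrite permM; by case: tpermP => // *; rewrite ?porbit_id ?porbit_closed.
Qed.

(** The factor [tperm] acts after [s]. Before step [i] the [s]-orbit of [x] meets neither [x] again
    nor [iter i s x], so the transposition has no effect. *)
Lemma iter_tperm_split s x i k : (0 < i < #|porbit s x|)%N -> (k < i)%N ->
  iter k (s * tperm x (iter i s x)) x = iter k s x.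
Proof.
move=> /andP[i0 im]; elim: k => //= k IH lt; rewrite IH ?permM 1?ltnW //.
rewrite -iterS tpermD //; apply/eqP=> E.
  have := @iter_porbit_inj s x 0 k.+1.
  by rewrite (leq_trans _ im) // (ltn_trans lt im) => /(_ isT isT E).
have := @iter_porbit_inj s x i k.+1.
by rewrite im (ltn_trans lt im) => /(_ isT isT E) E'; rewrite E' ltnn in lt.
Qed.

Lemma card_porbit_split s x i : (0 < i < #|porbit s x|)%N ->
  #|porbit (s * tperm x (iter i s x)) x| = i.
Proof.
move=> ib; have /andP[i0 im] := ib; apply: card_porbit_iter => //.
  case: i i0 im ib => // i _ im ib.
  by rewrite [LHS]iterS iter_tperm_split // permM -iterS tpermR.
move=> k /andP[k0 ki]; rewrite iter_tperm_split //; apply/eqP => E.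
have := @iter_porbit_inj s x k 0.
by rewrite (ltn_trans ki im) (leq_trans _ im) // => /(_ isT isT E) E0; rewrite E0 in k0.
Qed.

Lemma split_notin s x i : (0 < i < #|porbit s x|)%N ->
  iter i s x \notin porbit (s * tperm x (iter i s x)) x.
Proof.
move=> ib; have /andP[i0 im] := ib.
apply/negP => /porbit_iter_lt[k]; rewrite card_porbit_split // => ki.
rewrite iter_tperm_split // => /iter_porbit_inj -/(_ im (ltn_trans ki im)) E.
by rewrite E ltnn in ki.
Qed.

(** Seen from [iter i s x], the point [x] is [#|porbit s x| - i] steps ahead, so this is
    [card_porbit_split] with the two points exchanged. *)
Lemma card_porbit_split2 s x i : (0 < i < #|porbit s x|)%N ->
  #|porbit (s * tperm x (iter i s x)) (iter i s x)| = (#|porbit s x| - i)%N.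
Proof.
move=> ib; have /andP[i0 im] := ib; rewrite tpermC.
have pe : porbit s (iter i s x) = porbit s x by apply/porbit_mem_eq/porbit_iter.
have xE : x = iter (#|porbit s x| - i) s (iter i s x).
  by rewrite -iterD subnK 1?ltnW // iter_porbit.
rewrite {2}xE card_porbit_split // pe subn_gt0 im ltn_subrL i0.
exact: leq_trans im.
Qed.

Lemma porbit_split s x i : (0 < i < #|porbit s x|)%N ->
  let s' := s * tperm x (iter i s x) in
  porbit s x = porbit s' x :|: porbit s' (iter i s x) /\
  [disjoint porbit s' x & porbit s' (iter i s x)].
Proof.
move=> ib s'; have /andP[i0 im] := ib.
have dj : [disjoint porbit s' x & porbit s' (iter i s x)].
  apply/pred0P=> u /=; apply/negP=> /andP[/porbit_mem_eq E1 /porbit_mem_eq E2].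
  by have := split_notin ib; rewrite -/s' -E1 E2 porbit_id.
split=> //; apply/esym/eqP; rewrite eqEcard; apply/andP; split.
  by rewrite subUset !porbit_tperm_sub ?porbit_iter ?porbit_id.
rewrite cardsU (disjoint_setI0 dj) cards0 subn0.
by rewrite card_porbit_split // card_porbit_split2 // subnKC // ltnW.
Qed.

Lemma iter_tperm_merge s x y k : y \notin porbit s x ->
  (k < #|porbit s x|)%N -> iter k (s * tperm x y) x = iter k s x.
Proof.
move=> yx; elim: k => //= k IH lt; rewrite IH ?permM 1?ltnW //.
rewrite -iterS tpermD //; apply/eqP=> E.
  have := @iter_porbit_inj s x 0 k.+1.
  by rewrite (leq_trans _ lt) // lt => /(_ isT isT E).
by case/negP: yx; rewrite E porbit_iter.
Qed.

(** A join is a cut read backwards: once [y] is seen to lie on the new orbit of [x], the same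
    transposition cuts that orbit and gives back [s]. *)
Lemma porbit_merge s x y : y \notin porbit s x ->
  porbit (s * tperm x y) x = porbit s x :|: porbit s y.
Proof.
move=> yx; set s' := s * _.
have m0 : (0 < #|porbit s x|)%N by apply: porbit_gt0.
(* The step of [s] that would close the orbit of [x] is redirected to [y]. *)
have yx' : y \in porbit s' x.
  apply/porbit_iterP; exists #|porbit s x|; case Em : #|_| m0 => [//|k] _.
  rewrite /= iter_tperm_merge ?Em // permM -iterS -Em iter_porbit.
  by rewrite tpermL.
have xy : y != x by apply: contraNneq yx => ->; apply: porbit_id.
have [i im yE] := porbit_iter_lt yx'.
have ib : (0 < i < #|porbit s' x|)%N.
  by rewrite im andbT; case: i yE {im} => // yE; rewrite yE eqxx in xy.
have [-> _] := porbit_split ib.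
by rewrite -yE /s' -mulgA tperm2 mulg1.
Qed.

Lemma porbit_mulVl s t z : porbit (t * s) z = porbit (s^-1 * t^-1) z.
Proof. by rewrite -porbitV invMg. Qed.

End PorbitTperm.

(** * Cycles formed by two matchings *)

Section TwoInvolutions.
Variables (T : finType) (b : {perm T}).
Hypotheses (bK : involutive b) (b_neq : forall x, b x != x).
Implicit Types (M : {perm T}) (x y z : T).
Local Open Scope group_scope.

(** A perfect matching is encoded as the involution exchanging the two ends of each edge. *)
Definition fpf M := involutive M /\ forall x, M x != x.

(* The orbit contains every second vertex of the cycle through [x] formed by the
   edges of [b] and of [M]; the other vertices form the orbit of [b x]. *)
Definition orb M x := porbit (b * M) x.

Lemma orb_id M x : x \in orb M x. Proof. exact: porbit_id. Qed.

Lemma orb_sym M x y : (x \in orb M y) = (y \in orb M x).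
Proof. exact: porbit_sym. Qed.

Lemma orb_eq M x y : y \in orb M x -> orb M y = orb M x.
Proof. exact: porbit_mem_eq. Qed.

Lemma card_orb_gt0 M x : (0 < #|orb M x|)%N.
Proof. exact: porbit_gt0. Qed.

Section OneMatching.
Variable M : {perm T}.
Hypothesis fM : fpf M.
Let MK : involutive M := fM.1.

(** Conjugation by [b] inverts [b * M], so [b] carries orbits to orbits. *)
Lemma orb_b_mem x y : y \in orb M x -> b y \in orb M (b x).
Proof.
case/porbit_iterP=> i ->; rewrite porbit_sym; apply/porbit_iterP; exists i.
elim: i => //= i IH; rewrite -iterS iterSr {1}IH.
by congr (iter _ _ _); rewrite !permM bK MK.
Qed.

Lemma orb_b x : orb M (b x) = b @: orb M x.
Proof.
apply/setP=> y; apply/idP/imsetP.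
  by move=> /orb_b_mem; rewrite bK => h; exists (b y); rewrite ?bK.
by case=> z hz ->; apply: orb_b_mem.
Qed.

Lemma card_orb_b x : #|orb M (b x)| = #|orb M x|.
Proof. by rewrite orb_b card_imset //; apply: perm_inj. Qed.

(** If [iter i (b * M) z = b z], peeling a factor off each end gives the same relation for [i - 2]
    at [(b * M) z], and eventually a fixed point of [b] or of [M]. *)
Lemma orb_b_notin x : b x \notin orb M x.
Proof.
suff H i z : iter i (b * M) z != b z.
  by apply/negP => /porbit_iterP[i E]; have := H i x; rewrite -E eqxx.
suff: (iter i (b * M) z != b z) /\ (iter i.+1 (b * M) z != b z) by case.
elim: i z => [|i IH] z.
  by rewrite /= permM eq_sym; split; [apply: b_neq | apply: fM.2].
split; first by case: (IH z).
apply/negP; rewrite iterS iterSr permM => /eqP/(canRL MK)/(canRL bK) E.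
by have [/negP[]] := IH ((b * M) z); rewrite E permM.
Qed.

Lemma orb_b_notinV x y : y \in orb M x -> b y \notin orb M x.
Proof. by move=> h; rewrite -(orb_eq h) orb_b_notin. Qed.

Lemma mem_orb_bb x y : (b y \in orb M (b x)) = (y \in orb M x).
Proof.
by apply/idP/idP => [/orb_b_mem|]; [rewrite !bK | apply: orb_b_mem].
Qed.

Lemma mem_orb_bC x y : (b y \in orb M x) = (y \in orb M (b x)).
Proof. by rewrite -mem_orb_bb bK. Qed.

End OneMatching.

(** * Exchanging two points in one of the matchings *)

Lemma fpfJ M s : fpf M -> fpf (M ^ s).
Proof.
case=> MK Mx; split=> x; rewrite -[x](permKV s) permJ.
  by rewrite permJ MK.
by rewrite (inj_eq perm_inj).
Qed.

(** Conjugating the matching thus multiplies [b * M] by two transpositions, one on each side, whose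
    effects on orbits can be studied one after the other. *)
Lemma mul_conj_tperm M x y :
  b * M ^ tperm x y = tperm (b x) (b y) * (b * M * tperm x y).
Proof.
apply/permP=> z; rewrite /conjg tpermV !permM.
by rewrite (inj_tperm _ _ _ (can_inj bK)) !bK.
Qed.

Section Swap.
Variables (M : {perm T}) (x y : T).
Hypothesis fM : fpf M.
Let c1 := b * M * tperm x y.
Let M' := M ^ tperm x y.
Let fM' : fpf M' := fpfJ _ fM.

(** A permutation and its inverse have the same orbits; inverting moves the left transposition to
    the right, where [porbit_tperm_other] applies. *)
Lemma orb_swap1 z : z \notin porbit c1 (b x) -> z \notin porbit c1 (b y) ->
  orb M' z = porbit c1 z.
Proof.
move=> hx hy; rewrite /orb /M' mul_conj_tperm porbit_mulVl tpermV.
by rewrite porbit_tperm_other porbitV.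
Qed.

Lemma orb_swap_other z : z \notin orb M x -> z \notin orb M y ->
  z \notin orb M (b x) -> z \notin orb M (b y) -> orb M' z = orb M z.
Proof.
move=> zx zy zbx zby; have E : porbit c1 z = orb M z by rewrite porbit_tperm_other.
by rewrite orb_swap1 ?E // porbit_sym E orb_sym.
Qed.

Lemma orb_join_b_notin u : y \notin orb M x -> y \notin orb M (b x) ->
  u \in orb M x :|: orb M y -> b u \notin orb M x :|: orb M y.
Proof.
move=> yx ybx.
have h : b x \notin orb M y by rewrite mem_orb_bC // orb_sym mem_orb_bC // orb_sym -mem_orb_bC // bK.
have h' : b y \notin orb M x by rewrite mem_orb_bC.
rewrite !inE => /orP[] hu; rewrite negb_or (orb_b_notinV fM hu) ?andbT /=.
  apply: contra h => buy.
  by rewrite -(orb_eq buy) orb_sym orb_b_mem.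
apply: contra h' => bux.
by rewrite -(orb_eq bux) orb_sym orb_b_mem.
Qed.

(** The transposition of [x] and [y] joins their orbits. The other one concerns [b x] and [b y],
    which by [orb_join_b_notin] lie outside the union. *)
Lemma orb_swap_join z : y \notin orb M x -> y \notin orb M (b x) ->
  z \in orb M x :|: orb M y -> orb M' z = orb M x :|: orb M y.
Proof.
move=> yx ybx; have E : porbit c1 x = orb M x :|: orb M y by apply: porbit_merge.
rewrite -E => zc; rewrite -(porbit_mem_eq zc).
apply: orb_swap1; rewrite porbit_sym (porbit_mem_eq zc) E orb_join_b_notin // inE orb_id ?orbT //.
Qed.

Lemma orb_swap_split z i : (0 < i < #|orb M x|)%N ->
  y = iter i (b * M) x -> z \in orb M x -> orb M' z = porbit c1 z.
Proof.
move=> ib yE zx; have yx : y \in orb M x by rewrite yE porbit_iter.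
have bE u : u \in orb M x -> porbit c1 (b u) = orb M (b u).
  move=> ux; rewrite porbit_tperm_other // -/(orb _ _) ?(orb_eq yx) orb_b_notinV //.
by apply: orb_swap1; rewrite bE ?orb_id // orb_sym (orb_eq zx) orb_b_notinV ?orb_id.
Qed.

(** One transposition joins the two halves of the cycle and the other cuts the result into two new
    orbits. As [b] exchanges these, they have equal size, that of the old halves. *)
Lemma card_orb_swap_twist z : y \in orb M (b x) ->
  z \in orb M x :|: orb M (b x) -> #|orb M' z| = #|orb M x|.
Proof.
move=> ybx; set S := _ :|: _ => zS.
have yx : y \notin orb M x.
  by rewrite -(bK y) orb_b_notinV // mem_orb_bC.
have c1E : porbit c1 x = S by rewrite porbit_merge // -!/(orb _ _) (orb_eq ybx).
have bS u : u \in S -> b u \in S.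
  by rewrite /S !inE mem_orb_bC // mem_orb_bb // orbC.
have xS : x \in S by rewrite inE orb_id.
have yS : y \in S by rewrite inE ybx orbT.
have c1S u : u \in S -> porbit c1 u = S.
  by rewrite -c1E => /porbit_mem_eq.
have: b y \in porbit c1^-1 (b x) by rewrite porbitV c1S ?bS.
case/porbit_iter_lt=> i im byE.
have ib : (0 < i < #|porbit c1^-1 (b x)|)%N.
  rewrite im andbT; case: i byE {im} => // /perm_inj yxE.
  by rewrite yxE orb_id in yx.
have M'E u : orb M' u = porbit (c1^-1 * tperm (b x) (b y)) u.
  by rewrite /orb /M' mul_conj_tperm porbit_mulVl tpermV.
have [] := porbit_split ib; rewrite porbitV c1S ?bS // -byE -!M'E => SE dj.
have cardS : #|S| = (#|orb M x| + #|orb M x|)%N.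
  rewrite cardsU card_orb_b // (_ : _ :&: _ = set0) ?cards0 ?subn0 //.
  apply/setP=> u; rewrite !inE; apply/negP=> /andP[ux].
  by rewrite -mem_orb_bC // (negPf (orb_b_notinV fM ux)).
have two u : u \in S -> #|S| = (#|orb M' u| + #|orb M' u|)%N.
  move=> uS; rewrite -{2}(card_orb_b fM' u).
  rewrite {1}SE cardsU (disjoint_setI0 dj) cards0 subn0.
  have nu := orb_b_notin fM' u.
  move: (uS) (bS _ uS); rewrite SE !inE => /orP[] hu /orP[] hbu;
    move: nu; rewrite (orb_eq hu) ?(orb_eq hbu) ?hbu // => _.
  exact: addnC.
by have := two _ zS; rewrite cardS !addnn => /double_inj.
Qed.

End Swap.

(** * Orbit lengths recorded by weighted sums *)

Section Sums.
Implicit Type g : nat -> nat.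

(** [U] and its image under [b] are disjoint and contribute equally, hence the doubling. Old and new
    terms stand on opposite sides to avoid subtraction in [nat]. *)
Lemma sum_swap_halves M M' (U : {set T}) g : fpf M -> fpf M' ->
  (forall z, z \in U -> b z \notin U) ->
  (forall z, z \notin U -> b z \notin U -> #|orb M' z| = #|orb M z|) ->
  (\sum_z g #|orb M' z| + (\sum_(z in U) g #|orb M z|).*2 =
   \sum_z g #|orb M z| + (\sum_(z in U) g #|orb M' z|).*2)%N.
Proof.
move=> fM fM' dj out.
have E N : fpf N -> (\sum_z g #|orb N z| = (\sum_(z in U) g #|orb N z|).*2 +
    \sum_(z | (z \notin U) && (b z \notin U)) g #|orb N z|)%N.
  move=> fN; rewrite (bigID (mem U)) /= -addnn -addnA; congr (_ + _)%N.
  rewrite (bigID (fun z => b z \in U)) /=; congr (_ + _)%N.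
  rewrite [RHS](reindex_inj (@perm_inj _ b)) /=.
  apply: eq_big => [z|z _]; last by rewrite card_orb_b.
  by case: (boolP (b z \in U)) => [/dj|]; rewrite ?bK ?andbF // => ->.
rewrite (E M) // (E M') //.
have -> : (\sum_(z | (z \notin U) && (b z \notin U)) g #|orb M' z| =
           \sum_(z | (z \notin U) && (b z \notin U)) g #|orb M z|)%N.
  by apply: eq_bigr => z /andP[h1 h2]; rewrite out.
by rewrite addnAC addnC addnA [(_ + (\sum_(z in U) _).*2)%N]addnC addnA.
Qed.

Lemma sum_orb M x g : (\sum_(z in orb M x) g #|orb M z| = #|orb M x| * g #|orb M x|)%N.
Proof.
rewrite (eq_bigr (fun=> g #|orb M x|)) ?sum_nat_const // => z /orb_eq -> //.
Qed.

Lemma sum_disjointU (A B : {set T}) (F : T -> nat) : [disjoint A & B] ->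
  (\sum_(z in A :|: B) F z = \sum_(z in A) F z + \sum_(z in B) F z)%N.
Proof. by move=> dj; rewrite -bigU //; apply: eq_bigl => z; rewrite !inE. Qed.

(** An orbit of length m contributes m g(m), and its image under [b] as much again. Letting [g] vary
    records the whole multiset of lengths. *)
Lemma sum_join M x y g : fpf M -> y \notin orb M x -> y \notin orb M (b x) ->
  let m := #|orb M x| in let q := #|orb M y| in
  (\sum_z g #|orb (M ^ tperm x y) z| + (m * g m + q * g q).*2 =
   \sum_z g #|orb M z| + ((m + q) * g (m + q)).*2)%N.
Proof.
move=> fM yx ybx m q; set M' := M ^ _; have fM' : fpf M' := fpfJ _ fM.
have dj : [disjoint orb M x & orb M y].
  apply/pred0P=> u /=; apply/negP=> /andP[/orb_eq E1 /orb_eq E2].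
  by rewrite -E1 E2 orb_id in yx.
have cardU : #|orb M x :|: orb M y| = (m + q)%N.
  by rewrite cardsU (disjoint_setI0 dj) cards0 subn0.
have := @sum_swap_halves M M' (orb M x :|: orb M y) g fM fM'.
rewrite (sum_disjointU _ dj) !sum_orb -/m -/q.
have -> : (\sum_(z in orb M x :|: orb M y) g #|orb M' z| = (m + q) * g (m + q))%N.
  rewrite (eq_bigr (fun=> g (m + q)%N)) ?sum_nat_const ?cardU // => z zU.
  by rewrite orb_swap_join // cardU.
apply.
  by move=> z; apply: orb_join_b_notin.
move=> z; rewrite !inE !negb_or => /andP[zx zy] /andP[bzx bzy].
by rewrite orb_swap_other // -mem_orb_bC.
Qed.

Lemma sum_split M x i g : fpf M -> (0 < i < #|orb M x|)%N ->
  let m := #|orb M x| in let y := iter i (b * M) x in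
  (\sum_z g #|orb (M ^ tperm x y) z| + (m * g m).*2 =
   \sum_z g #|orb M z| + (i * g i + (m - i) * g (m - i)).*2)%N.
Proof.
move=> fM ib m y; set M' := M ^ _; have fM' : fpf M' := fpfJ _ fM.
have := @sum_swap_halves M M' (orb M x) g fM fM'.
rewrite sum_orb -/m.
have -> : (\sum_(z in orb M x) g #|orb M' z| = i * g i + (m - i) * g (m - i))%N.
  have [SE dj] := porbit_split ib; rewrite -/y -/(orb M x) in SE dj.
  rewrite (eq_bigr (fun z => g #|porbit (b * M * tperm x y) z|)); last first.
    by move=> z zx; rewrite (orb_swap_split fM ib).
  rewrite SE sum_disjointU //; congr (_ + _)%N.
    rewrite (eq_bigr (fun=> g i)) ?sum_nat_const ?card_porbit_split //.
    by move=> z /porbit_mem_eq ->; rewrite card_porbit_split.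
  rewrite (eq_bigr (fun=> g (m - i)%N)) ?sum_nat_const ?card_porbit_split2 //.
  by move=> z /porbit_mem_eq ->; rewrite card_porbit_split2.
apply; first by move=> z; apply: orb_b_notinV.
move=> z zx bzx; have yx : orb M y = orb M x by apply/orb_eq/porbit_iter.
have ybx : orb M (b y) = orb M (b x) by rewrite !orb_b ?yx.
by rewrite orb_swap_other ?yx ?ybx // -mem_orb_bC.
Qed.

Lemma sum_twist M x y g : fpf M -> y \in orb M (b x) ->
  (\sum_z g #|orb (M ^ tperm x y) z| = \sum_z g #|orb M z|)%N.
Proof.
move=> fM ybx; apply: eq_bigr => z _; congr g.
have [zS|] := boolP (z \in orb M x :|: orb M (b x)).
  rewrite (card_orb_swap_twist fM ybx zS).
  by move: zS; rewrite inE => /orP[] /orb_eq->; rewrite ?card_orb_b.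
rewrite inE negb_or => /andP[zx zbx].
have byx : orb M (b y) = orb M x by rewrite orb_b // (orb_eq ybx) -orb_b // bK.
by rewrite orb_swap_other ?(orb_eq ybx) ?byx.
Qed.

End Sums.
End TwoInvolutions.

(** * Coset types *)

Section CosetType.
Variable n : nat.
Implicit Types (s h : {perm bpoint n}) (x y z : bpoint n) (g : nat -> nat).

Lemma barK : involutive (@bar n).
Proof. by case=> i e; rewrite /bar /= negbK. Qed.

Lemma bar_neq x : bar x != x.
Proof. by case: x => i []; apply/negP=> /eqP[]. Qed.

Definition barp : {perm bpoint n} := perm (can_inj barK).

Lemma barpE x : barp x = bar x. Proof. by rewrite permE. Qed.

Lemma barpK : involutive barp.
Proof. by move=> x; rewrite !barpE barK. Qed.

Lemma barp_neq x : barp x != x.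
Proof. by rewrite barpE bar_neq. Qed.

Lemma fpf_barp s : fpf (barp ^ s)%g.
Proof. by apply: fpfJ; split; [apply: barpK | apply: barp_neq]. Qed.

(* [(barp ^ s)%g], which is s \o bar \o s^-1, is the matching of the dashed
   edges. *)
Definition half_cycle s := orb barp (barp ^ s)%g.
Definition half_length s x := #|half_cycle s x|.

Lemma coset_graphE s x y :
  coset_graph s x y = (y == barp x) || (y == (barp ^ s)%g x).
Proof.
rewrite /coset_graph; congr (_ || _).
  apply/existsP/eqP => [[z /andP[/eqP-> /eqP->]]|->]; first by rewrite barpE.
  by exists x; rewrite barpE !eqxx.
apply/existsP/eqP => [[z /andP[/eqP-> /eqP->]]|->]; first by rewrite permJ barpE.
exists (s^-1 x)%g; rewrite permKV eqxx /=.
by rewrite -[X in (barp ^ s)%g X](permKV s) permJ barpE.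
Qed.

Lemma coset_graph_sym s : symmetric (coset_graph s).
Proof.
have [MK _] := fpf_barp s.
move=> x y; rewrite !coset_graphE; congr (_ || _).
  by rewrite -{2}(barpK x) (inj_eq perm_inj) eq_sym.
by rewrite -{2}(MK x) (inj_eq perm_inj) eq_sym.
Qed.

(** Every edge, solid or dashed, exchanges the two half cycles of a component; conversely, one step
    along a half cycle is a path of two edges. *)
Lemma connect_coset_graph s x y :
  connect (coset_graph s) x y = (y \in half_cycle s x :|: half_cycle s (barp x)).
Proof.
have fM := fpf_barp s; have [MK _] := fM.
apply/idP/idP.
  case/connectP=> p pth ->; elim: p x pth => [|z p IH] x /=.
    by rewrite inE orb_id.
  case/andP=> xz /IH; suff -> : half_cycle s z :|: half_cycle s (barp z) = half_cycle s x :|: half_cycle s (barp x) by [].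
  rewrite coset_graphE in xz; case/orP: xz => /eqP->; first by rewrite barpK setUC.
  have zE : (barp ^ s)%g x \in half_cycle s (barp x).
    by apply/porbit_iterP; exists 1%N; rewrite /= permM barpK.
  rewrite [X in X :|: _](orb_eq zE) setUC; congr (_ :|: _).
  have := orb_b_mem barpK fM zE; rewrite barpK => /orb_eq; exact.
have cx u : connect (coset_graph s) u (barp u).
  by apply: connect1; rewrite coset_graphE eqxx.
have orbc u v : v \in half_cycle s u -> connect (coset_graph s) u v.
  case/porbit_iterP=> i -> {v}; elim: i => [|i IH] //=.
  apply: connect_trans IH _; rewrite permM.
  apply: connect_trans (cx _) _; apply: connect1.
  by rewrite coset_graphE eqxx orbT.
rewrite inE => /orP[/orbc //|/orbc]; apply: connect_trans; exact: cx.
Qed.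

Lemma half_length_barp s x : half_length s (barp x) = half_length s x.
Proof. by rewrite /half_length /half_cycle card_orb_b //; [apply: barpK | apply: fpf_barp]. Qed.

Lemma half_length_eq s x y : y \in half_cycle s x -> half_length s y = half_length s x.
Proof. by rewrite /half_length => /orb_eq; rewrite /half_cycle => ->. Qed.

Lemma half_cycle_disjoint s x : [disjoint half_cycle s x & half_cycle s (barp x)].
Proof.
apply/pred0P=> u /=; apply/negP=> /andP[ux].
rewrite -mem_orb_bC; [|exact: barpK|exact: fpf_barp].
by apply/negP; apply: orb_b_notinV ux; [apply: barpK | apply: barp_neq | apply: fpf_barp].
Qed.

Lemma cycle_supports_partition s : partition (cycle_supports s) [set: bpoint n].
Proof.
have csym : connect_sym (coset_graph s).
  by apply: sym_connect_sym; apply: coset_graph_sym.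
apply: equivalence_partitionP => x y z _ _ _; split; first exact: connect0.
by move=> xy; apply/idP/idP; apply: connect_trans; rewrite // csym.
Qed.

Lemma cycle_supportsP s (C : {set bpoint n}) : C \in cycle_supports s ->
  exists x, C = half_cycle s x :|: half_cycle s (barp x) /\ #|C| = (half_length s x).*2.
Proof.
case/imsetP=> x _ ->; exists x.
set D := [set _ in _ | _]; have -> : D = half_cycle s x :|: half_cycle s (barp x).
  by apply/setP=> y; rewrite inE in_setT connect_coset_graph.
split=> //; rewrite cardsU (disjoint_setI0 (half_cycle_disjoint s x)) cards0 subn0.
by rewrite -/(half_length s x) -/(half_length s (barp x)) half_length_barp addnn.
Qed.

(** A part p is the half length of exactly the 2p points of its cycle, so sums over parts become
    sums over points. *)
Lemma sum_coset_type (V : nmodType) (f : nat -> V) s :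
  \sum_(p <- coset_type s) f p *+ p.*2 = \sum_z f (half_length s z).
Proof.
rewrite [RHS](eq_bigl [in [set: bpoint n]]); last by move=> z; rewrite inE.
rewrite (set_partition_big _ (cycle_supports_partition s)) /=.
rewrite /coset_type (perm_big _ (permEl (perm_sort _ _))) big_map big_enum /=.
apply: eq_bigr => C /cycle_supportsP[x [CE cC]].
rewrite cC doubleK (eq_bigr (fun=> f (half_length s x))) ?sumr_const ?cC //.
by move=> z; rewrite CE inE => /orP[] /half_length_eq ->; rewrite // half_length_barp.
Qed.

Lemma sum_coset_type_nat s g :
  (\sum_(p <- coset_type s) p.*2 * g p = \sum_z g (half_length s z))%N.
Proof.
apply/eqP; rewrite -(eqr_nat rat) !natr_sum.
rewrite -(sum_coset_type (fun p => (g p)%:R : rat)); apply/eqP.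
by apply: eq_bigr => p _; rewrite natrM mulr_natl.
Qed.

Lemma coset_type_gt0 s : 0%N \notin coset_type s.
Proof.
rewrite /coset_type mem_sort; apply/mapP=> -[C]; rewrite mem_enum.
case/cycle_supportsP=> x [_ ->]; rewrite doubleK => E.
by have := card_orb_gt0 barp (barp ^ s)%g x; rewrite -/(half_cycle s x) -/(half_length s x) -E.
Qed.

Lemma coset_type_sorted s : sorted geq (coset_type s).
Proof. by apply: sort_sorted => p q; apply: leq_total. Qed.

Lemma sumn_coset_type s : sumn (coset_type s) = n.
Proof.
have := sum_coset_type_nat s (fun=> 1%N).
rewrite sum1_card card_prod card_ord card_bool muln2.
rewrite (eq_bigr (fun p => 2 * p)%N) => [|p _]; last by rewrite muln1 mul2n.
by rewrite -big_distrr -sumnE /= mul2n => /double_inj.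
Qed.

Lemma coset_type_partition s : is_partition n (coset_type s).
Proof. by rewrite /is_partition coset_type_sorted coset_type_gt0 sumn_coset_type eqxx. Qed.

Lemma half_length_mem s x : half_length s x \in coset_type s.
Proof.
have partP := cycle_supports_partition s.
have xcov : x \in cover (cycle_supports s) by rewrite (cover_partition partP).
have Cx := pblock_mem xcov; have [y [CE cC]] := cycle_supportsP Cx.
rewrite mem_sort; apply/mapP; exists (pblock (cycle_supports s) x).
  by rewrite mem_enum.
rewrite cC doubleK; have : x \in pblock (cycle_supports s) x by rewrite mem_pblock.
by rewrite CE inE => /orP[] /half_length_eq ->; rewrite ?half_length_barp.
Qed.

Definition outside s x := [pred z | z \notin half_cycle s x :|: half_cycle s (barp x)].

Lemma sum_outside (V : zmodType) (f : nat -> V) s x :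
  \sum_(z | outside s x z) f (half_length s z) =
  \sum_(p <- rem (half_length s x) (coset_type s)) f p *+ p.*2.
Proof.
have := sum_coset_type f s.
rewrite (perm_big _ (perm_to_rem (half_length_mem s x))) big_cons /=.
rewrite [RHS](bigID [in half_cycle s x :|: half_cycle s (barp x)]) /=.
have -> : \sum_(z in half_cycle s x :|: half_cycle s (barp x)) f (half_length s z) = f (half_length s x) *+ (half_length s x).*2.
  rewrite (eq_bigr (fun=> f (half_length s x))).
    rewrite sumr_const cardsU (disjoint_setI0 (half_cycle_disjoint s x)) cards0 subn0.
    by rewrite -/(half_length s x) -/(half_length s (barp x)) half_length_barp addnn.
  by move=> z; rewrite inE => /orP[] /half_length_eq ->; rewrite // half_length_barp.
by move/addrI.
Qed.

Lemma half_length_outside s x y : outside s x y ->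
  half_length s y \in rem (half_length s x) (coset_type s).
Proof.
(* With the indicator of the half length of [y], the sum over points is at least 1, while the sum
   over parts would be 0 if that part were missing. *)
move=> yo; have := sum_outside (fun p => (p == half_length s y)%:R : rat) s x.
rewrite (bigD1 y) //= eqxx => E; apply/negPn/negP => h.
suff: (0 : rat) < 0 by rewrite ltxx.
rewrite [ltRHS](_ : _ = 1 + \sum_(z | outside s x z && (z != y)) (half_length s z == half_length s y)%:R).
  by rewrite ltr_wpDr // sumr_ge0 // => z _; rewrite ler0n.
rewrite E big_seq big1 // => p pt; case: eqP => [pE|]; last by rewrite mul0rn.
by rewrite -pE pt in h.
Qed.

End CosetType.

Lemma sum_weight_indicator (s : seq nat) (q : nat) :
  (\sum_(p <- s) p.*2 * (p == q) = q.*2 * count_mem q s)%N.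
Proof.
elim: s => [|p s IH]; first by rewrite big_nil muln0.
by rewrite big_cons IH /= mulnDr; case: eqP => [->|]; rewrite ?muln0 ?muln1.
Qed.

(* The indicator of [q] as a weight recovers the multiplicity of [q]. *)
Lemma perm_eq_weights (s t : seq nat) : 0%N \notin s -> 0%N \notin t ->
  (forall g : nat -> nat,
     (\sum_(p <- s) p.*2 * g p = \sum_(p <- t) p.*2 * g p)%N) -> perm_eq s t.
Proof.
move=> s0 t0 E; apply/allP=> -[|q] _ /=.
  by rewrite (count_memPn s0) (count_memPn t0).
have /eqP := E (fun p => p == q.+1 : nat).
by rewrite !sum_weight_indicator eqn_pmul2l // => /eqP->.
Qed.

(** * The coset type after a transposition *)

Section TypeOfSwap.
Variable n : nat.
Implicit Types (s h : {perm bpoint n}) (x y z : bpoint n).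

Lemma half_cycle_mul_tperm s x y : half_cycle (s * tperm x y) =1 orb (barp n) ((barp n ^ s) ^ tperm x y).
Proof. by move=> z; rewrite /half_cycle conjgM. Qed.

Lemma coset_type_join s x y t : outside s x y ->
  perm_eq (coset_type s) [:: half_length s x, half_length s y & t] ->
  perm_eq (coset_type (s * tperm x y)) (half_length s x + half_length s y :: t)%N.
Proof.
rewrite /outside /= inE negb_or => /andP[yx ybx] E.
have := coset_type_gt0 s; rewrite (perm_mem E) !inE !negb_or => /and3P[m0 q0 t0].
apply: perm_eq_weights => [||g]; rewrite ?coset_type_gt0 //.
  by rewrite inE negb_or t0 andbT eq_sym addn_eq0 negb_and eq_sym m0.
have := sum_join (@barpK n) (@barp_neq n) g (fpf_barp s) yx ybx.
rewrite sum_coset_type_nat; have := sum_coset_type_nat s g.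
have -> : (\sum_(p <- coset_type s) p.*2 * g p = \sum_(p <- [:: half_length s x, half_length s y & t]) p.*2 * g p)%N.
  exact: perm_big.
rewrite !big_cons.
rewrite -!/(half_cycle s _) -!/(half_length s _).
under [in X in _ -> _ -> X]eq_bigr do rewrite /half_length half_cycle_mul_tperm.
set A := (\sum_z _)%N; set B := (\sum_(i <- t) _)%N; lia.
Qed.

Lemma coset_type_split s x i t : (0 < i < half_length s x)%N ->
  perm_eq (coset_type s) (half_length s x :: t) ->
  perm_eq (coset_type (s * tperm x (iter i (barp n * barp n ^ s)%g x)))
    [:: i, half_length s x - i & t]%N.
Proof.
move=> ib E; have /andP[i0 im] := ib.
have := coset_type_gt0 s; rewrite (perm_mem E) !inE !negb_or => /andP[m0 t0].
apply: perm_eq_weights => [||g]; rewrite ?coset_type_gt0 //.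
  by rewrite !inE !negb_or t0 andbT; lia.
have := sum_split (@barpK n) (@barp_neq n) g (fpf_barp s) ib.
rewrite sum_coset_type_nat; have := sum_coset_type_nat s g.
have -> : (\sum_(p <- coset_type s) p.*2 * g p = \sum_(p <- half_length s x :: t) p.*2 * g p)%N.
  exact: perm_big.
rewrite !big_cons.
rewrite -!/(half_cycle s _) -!/(half_length s _).
under [in X in _ -> _ -> X]eq_bigr do rewrite /half_length half_cycle_mul_tperm.
set A := (\sum_z _)%N; set B := (\sum_(i <- t) _)%N; lia.
Qed.

(* Explicit [etrans] steps: rewriting makes unification compare the coset types
   of distinct permutations by evaluating them. *)
Lemma coset_type_twist s x y : y \in half_cycle s (barp n x) ->
  coset_type (s * tperm x y) = coset_type s.
Proof.
move=> ybx; apply: (@sorted_eq _ geq).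
- by move=> a b c /=; lia.
- by move=> a b /=; lia.
- exact: coset_type_sorted.
- exact: coset_type_sorted.
apply: perm_eq_weights => [||g]; [exact: coset_type_gt0 | exact: coset_type_gt0 | ].
apply: etrans (sum_coset_type_nat _ g) _.
apply: etrans _ (esym (sum_coset_type_nat s g)).
apply: etrans _ (sum_twist (@barpK n) (@barp_neq n) g (fpf_barp s) ybx).
by apply: eq_bigr => z _; rewrite /half_length half_cycle_mul_tperm.
Qed.

End TypeOfSwap.

Lemma sum_porbit (T : finType) (V : nmodType) (s : {perm T}) x (G : T -> V) :
  \sum_(y in porbit s x) G y = \sum_(0 <= k < #|porbit s x|) G (iter k s x).
Proof.
rewrite (eq_bigl [in traject s x #|porbit s x|]) => [|y]; last exact: porbit_traject.
rewrite -big_uniq ?uniq_traject_porbit //=.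
elim: #|_| => [|k IH]; first by rewrite big_nil big_geq.
by rewrite trajectSr big_rcons big_nat_recr //= IH.
Qed.

Lemma geq_trans : transitive geq. Proof. by move=> a b c /=; lia. Qed.
Lemma geq_total : total geq. Proof. by move=> a b /=; lia. Qed.
Lemma geq_anti : antisymmetric geq. Proof. by move=> a b /=; lia. Qed.

Lemma coset_type_sort n r (s : {perm bpoint n}) :
  perm_eq (coset_type s) r -> coset_type s = sort geq r.
Proof.
move/(perm_sortP geq_total geq_trans geq_anti) <-.
by rewrite sorted_sort ?coset_type_sorted //; apply: geq_trans.
Qed.

(** * Transpositions involving the top index *)

Section Level.
Variable n : nat.
Implicit Types (s h : {perm bpoint n}) (x y z : bpoint n).
Local Notation b := (barp n).

Lemma barp1 x : (b x).1 = x.1. Proof. by rewrite barpE. Qed.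

Lemma sum_half_cycle (V : nmodType) s x (G : bpoint n -> V) :
  \sum_(y in half_cycle s x) G y = \sum_(0 <= k < half_length s x) G (iter k (b * b ^ s)%g x).
Proof. exact: sum_porbit. Qed.

(* Dashed and solid edges coincide at the points of index at least [l]. *)
Definition level l s := [forall x : bpoint n, (l <= x.1)%N ==> ((b ^ s)%g x == b x)].

Lemma levelP l s : reflect (forall x, (l <= x.1)%N -> (b ^ s)%g x = b x) (level l s).
Proof.
apply: (iffP forallP) => H x; last by apply/implyP=> /H/eqP.
by move=> lx; have /implyP/(_ lx)/eqP := H x.
Qed.

Lemma level_half_cycle l s x : level l s -> (l <= x.1)%N -> half_cycle s x = [set x].
Proof.
move/levelP=> ls lx; apply/setP=> y; rewrite inE; apply/idP/eqP => [|->]; last exact: orb_id.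
case/porbit_iterP=> k ->; elim: k => //= k ->.
by rewrite permM ls ?barp1 // barpK.
Qed.

Lemma level_half_length l s x : level l s -> (l <= x.1)%N -> half_length s x = 1%N.
Proof. by move=> ls lx; rewrite /half_length (level_half_cycle ls lx) cards1. Qed.

Section Top.
Variables (i : 'I_n) (s : {perm bpoint n}).
Hypothesis ls : level i.+1 s.
Let x0 : bpoint n := (i, false).
Let m := half_length s x0.
Let t := rem m (coset_type s).
Let comp := half_cycle s x0 :|: half_cycle s (b x0).

Lemma half_cycle_below x y : (x.1 <= i)%N -> y \in half_cycle s x -> (y.1 <= i)%N.
Proof.
move=> xi; rewrite leqNgt orb_sym; apply: contraTN => yi.
rewrite -/(half_cycle s y) (level_half_cycle ls yi) inE; apply: contraTneq yi => <-.
by rewrite -leqNgt.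
Qed.

Lemma top_point y : nat_of_ord y.1 = i -> y = x0 \/ y = b x0.
Proof.
rewrite barpE /bar /x0; case: y => j [] /= /val_inj ->; by [right | left].
Qed.

Lemma half_cycle_top1 y : y \in half_cycle s x0 -> (y.1 < i)%N = (y != x0).
Proof.
move=> yx; have := half_cycle_below (leqnn i : (x0.1 <= i)%N) yx.
rewrite leq_eqVlt => /orP[/eqP yi|yi]; last first.
  by rewrite yi; apply/esym; apply: contraTneq yi => ->; rewrite /= ltnn.
rewrite yi ltnn; case: (top_point yi) => yE; first by rewrite yE eqxx.
move: yx; rewrite yE => h; have := orb_b_notin (@barpK n) (@barp_neq n) (fpf_barp s) x0.
by rewrite -/(half_cycle s x0) h.
Qed.

Lemma outside_top y : outside s x0 y -> (y.1 < i)%N = ~~ (i < y.1)%N.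
Proof.
rewrite -leqNgt => yo; rewrite [RHS]leq_eqVlt; case: eqP => //= /top_point[] yE.
  by rewrite yE /outside /= inE orb_id in yo.
by rewrite yE /outside /= !inE !orb_id orbT in yo.
Qed.

(** The point [y] lies on the half cycle of [x0] (a cut), on the opposite half (type unchanged) or
    on another cycle (a join). Points of the cycle of [x0] have index at most [i], attained only by
    [x0] and [b x0], one on each half; so the first two cases have [m.-1] choices each. *)
Lemma sum_swap_top (F : seq nat -> rat) :
  \sum_(y : bpoint n | (y.1 < i)%N) F (coset_type (s * tperm y x0)%g) =
  \sum_(1 <= k < m) F (sort geq [:: k, (m - k)%N & t]) + F (coset_type s) *+ m.-1 +
  \sum_(y : bpoint n | (y.1 < i)%N && outside s x0 y)
     F (sort geq (m + half_length s y :: rem (half_length s y) t)%N).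
Proof.
have ctE := coset_type_sort.
have m0 : (0 < m)%N by apply: card_orb_gt0.
rewrite (bigID [in comp]) /=; congr (_ + _); last first.
  apply: eq_big => y //; case/andP=> yi yo; congr F.
  apply: ctE; rewrite tpermC; apply: coset_type_join => //.
  apply: perm_trans (perm_to_rem (half_length_mem s x0)) _; rewrite perm_cons.
  by apply: perm_to_rem; apply: half_length_outside.
rewrite (bigID [in half_cycle s x0]) /=; congr (_ + _).
  transitivity (\sum_(y in half_cycle s x0) if y != x0 then F (coset_type (s * tperm y x0)%g) else 0).
    rewrite -big_mkcondr; apply: eq_bigl => y; rewrite andbC inE.
    by case: (boolP (y \in half_cycle s x0)) => [yx|] //=; rewrite andbT half_cycle_top1.
  rewrite sum_half_cycle -/m [LHS]big_ltn //= eqxx /= add0r.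
  apply: eq_big_nat => k /andP[k0 km]; rewrite ifT; last first.
    apply/eqP=> E; have := @iter_porbit_inj _ (b * b ^ s)%g x0 k 0 km m0 E.
    by move=> k0'; rewrite k0' in k0.
  congr F; apply: ctE; rewrite tpermC; apply: coset_type_split; first by rewrite k0.
  exact: perm_to_rem (half_length_mem s x0).
have dj y : y \in half_cycle s x0 -> b y \notin half_cycle s x0.
  by apply: orb_b_notinV; [apply: barpK | apply: barp_neq | apply: fpf_barp].
(* Reindexing by [b] carries the opposite half cycle without [b x0] to the half cycle of [x0]
   without [x0]. *)
transitivity (\sum_(y in half_cycle s x0 | y != x0) F (coset_type s)).
  rewrite [LHS](reindex_inj (@perm_inj _ b)); apply: eq_big => [y|y].
    rewrite barp1 !inE -!/(b y) (mem_orb_bb (@barpK n) (fpf_barp s)) -/(half_cycle s x0).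
    case: (boolP (y \in half_cycle s x0)) => yx /=.
      by rewrite orbT andbT dj // andbT half_cycle_top1.
    by rewrite orbF -andbA andbN andbF.
  rewrite !inE (mem_orb_bb (@barpK n) (fpf_barp s)) => /andP[/andP[_ yc] yx].
  rewrite (negPf yx) /= in yc.
  apply: (congr1 F); rewrite tpermC. apply: coset_type_twist.
  exact: (orb_b_mem (@barpK n) (fpf_barp s) yc).
rewrite big_mkcondr sum_half_cycle -/m [LHS]big_ltn //= eqxx /= add0r.
rewrite (eq_big_nat _ _ (F2 := fun=> F (coset_type s))) => [|k /andP[k0 km]].
  by rewrite big_const_nat iter_addr_0 subn1.
rewrite ifT //; apply/eqP=> E.
have := @iter_porbit_inj _ (b * b ^ s)%g x0 k 0 km m0 E.
by move=> k0'; rewrite k0' in k0.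
Qed.

(** This makes the joins in [sum_swap_top] depend only on the coset type and on [m]: points of index
    above [i] all lie outside the cycle of [x0], with half length 1, and are subtracted. *)
Lemma sum_below_outside (f : nat -> rat) :
  \sum_(y : bpoint n | (y.1 < i)%N && outside s x0 y) f (half_length s y) =
  \sum_(p <- t) f p *+ p.*2 - \sum_(y : bpoint n | (i < y.1)%N) f 1%N.
Proof.
rewrite -(sum_outside f s x0) [in RHS](bigID (fun y : bpoint n => (i < y.1)%N)) /=.
set A := (X in _ = X + _ - _); set B := (X in _ = _ - X).
have -> : A = B; last first.
  rewrite [B + _]addrC addrK; apply: eq_bigl => y; rewrite andbC.
  by case: (boolP (_ \notin _)) => //= /outside_top.
apply: eq_big => [y|y /andP[_ yi]]; last by rewrite (level_half_length ls yi).
case: ltnP => yi; rewrite ?andbF // andbT; apply/negP; rewrite inE.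
by case/orP=> /half_cycle_below; rewrite ?barp1 => /(_ (leqnn _)); rewrite leqNgt yi.
Qed.

End Top.
End Level.

(** * Elementary and complete symmetric functions of commuting elements *)

Section SymmetricFunctions.
Variables (R : nzRingType) (X : nat -> R).
Hypothesis X_comm : forall i j, GRing.comm (X i) (X j).

(** The function h_k of the first [l] elements, split by whether the last one occurs. The inner
    [fix] stays in the same row, so that [X l'] may recur, and this factor stands on the left, where
    its action can be read off. *)
Fixpoint homog l : nat -> R :=
  if l is l'.+1 then
    fix h k := if k is k'.+1 then homog l' k + X l' * h k' else 1
  else fun k => (k == 0%N)%:R.

Fixpoint elem l k : R :=
  if l is l'.+1 then elem l' k + (if k is k'.+1 then X l' * elem l' k' else 0)
  else (k == 0%N)%:R.

Lemma homogSS l k : homog l.+1 k.+1 = homog l k.+1 + X l * homog l.+1 k.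
Proof. by []. Qed.

Lemma homog0 l : homog l 0 = 1. Proof. by case: l. Qed.

Lemma elem0 l : elem l 0 = 1.
Proof. by elim: l => //= l ->; rewrite addr0. Qed.

Lemma elemS l k : elem l.+1 k =
  elem l k + (if k is k'.+1 then X l * elem l k' else 0).
Proof. by []. Qed.

Lemma elemSS l k : elem l.+1 k.+1 = elem l k.+1 + X l * elem l k.
Proof. by []. Qed.

Lemma elem_comm l i k : GRing.comm (X i) (elem l k).
Proof.
elim: l k => [|l IH] k /=; first exact: commr_nat.
by apply: commrD; [apply: IH | case: k => [|k]; [apply: commr0 | apply: commrM]].
Qed.

Lemma elem0l k : elem 0 k = (k == 0%N)%:R. Proof. by []. Qed.

Lemma homog0l k : homog 0 k = (k == 0%N)%:R. Proof. by []. Qed.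

Arguments homog : simpl never.
Arguments elem : simpl never.

(** The identity E(-t) H(t) = 1 of generating functions, read off degree by degree; adding a
    variable multiplies E(-t) and H(t) by mutually inverse factors. *)
Lemma elem_homog l k :
  \sum_(j < k.+1) (-1) ^+ j * (elem l j * homog l (k - j)) = (k == 0%N)%:R.
Proof.
elim: l => [|l IH].
  rewrite big_ord_recl big1 ?addr0 => [|j _]; last by rewrite elem0l mul0r mulr0.
  by rewrite elem0l homog0l expr0 !mul1r subn0.
case: k IH => [|k] IH.
  by rewrite big_ord1 expr0 elem0 homog0 !mul1r.
rewrite -IH big_ord_recl [RHS]big_ord_recl !elem0 !subn0 !expr0 !mul1r homogSS -addrA.
congr (_ + _).
(* Both sides are expanded in products of [elem l] with [homog l.+1]. [G] collects those with an
   extra factor [X l]; up to boundary terms the sides differ by a shift of its index. *)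
pose F j := (-1) ^+ j * (elem l j * homog l.+1 (k.+1 - j)).
pose G j := (-1) ^+ j * (elem l j * (X l * homog l.+1 (k - j))).
have -> : \sum_(i < k.+1) (-1) ^+ bump 0 i * (elem l.+1 (bump 0 i) * homog l.+1 (k.+1 - bump 0 i))
   = \sum_(i < k.+1) (F i.+1 - G i).
  apply: eq_bigr => i _; rewrite /bump /= add1n subSS elemSS mulrDl mulrDr exprS.
  have -> : X l * elem l i = elem l i * X l by apply: elem_comm.
  rewrite /F /G exprS !mulN1r !mulNr. by rewrite ?subSS !mulrA.
rewrite [in RHS]big_ord_recr /= subnn homog0.
have -> : \sum_(i < k) (-1) ^+ bump 0 i * (elem l (bump 0 i) * homog l (k.+1 - bump 0 i))
   = \sum_(i < k) (F i.+1 - G i.+1).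
  apply: eq_bigr => i _; rewrite /bump /= add1n subSS /F /G subSS.
  rewrite -mulrBr -mulrBr; congr (_ * (_ * _)).
  have -> : (k - i)%N = (k - i.+1).+1 by have := ltn_ord i; lia.
  by rewrite homogSS addrK.
rewrite !big_split /= !sumrN.
rewrite [\sum_(i < k.+1) F _]big_ord_recr [\sum_(i < k.+1) G _]big_ord_recl /=.
have -> : X l * homog l.+1 k = G 0%N by rewrite /G expr0 mul1r elem0 mul1r subn0.
have -> : F k.+1 = (-1) ^+ bump 0 k * (elem l (bump 0 k) * 1).
  by rewrite /F subnn homog0 /bump add1n.
under [\sum_(i < k) G (bump 0 i)]eq_bigr do rewrite /bump add1n.
set a := \sum_(i < k) _; set c := \sum_(i < k) _; set d := _ * (_ * 1).
by rewrite opprD addrCA [G _ + _]addrA subrr add0r addrAC.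
Qed.

Lemma homog_unfold l k :
  homog l k.+1 = \sum_(h < l) X h * homog h.+1 k.
Proof.
elim: l => [|l IH]; first by rewrite big_ord0.
by rewrite homogSS IH big_ord_recr.
Qed.

Lemma prod_rev (I : Type) (x : I -> R) (s : seq I) :
  (forall i j, GRing.comm (x i) (x j)) ->
  \prod_(i <- rev s) x i = \prod_(i <- s) x i.
Proof.
move=> xC; elim: s => [|i s IH] //.
rewrite rev_cons big_rcons big_cons IH /=.
elim: s {IH} => [|j s IH]; first by rewrite !big_nil mul1r mulr1.
by rewrite !big_cons -mulrA IH mulrA (xC j i : x j * x i = _) mulrA.
Qed.

(** * Sums over sorted tuples *)

Section Tuples.
Variable n : nat.

Lemma big_tuple_cons (V : nmodType) k (P : pred (seq 'I_n)) (F : seq 'I_n -> V) :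
  \sum_(t : k.+1.-tuple 'I_n | P t) F t =
  \sum_(h < n) \sum_(t : k.-tuple 'I_n | P (h :: t)) F (h :: t).
Proof.
rewrite pair_big_dep /=.
rewrite (reindex (fun p : 'I_n * k.-tuple 'I_n => cons_tuple p.1 p.2)) //.
exists (fun t : k.+1.-tuple 'I_n => (thead t, [tuple of behead t])) => [[h t] _|t _] /=.
  by rewrite theadE; congr (_, _); apply: val_inj.
by apply: val_inj; rewrite /= {3}[t]tuple_eta.
Qed.

Lemma sum_path_homog k (h : 'I_n) :
  \sum_(t : k.-tuple 'I_n | path geq h (map val t)) \prod_(i <- t) X (val i) =
  homog h.+1 k.
Proof.
elim: k h => [|k IH] h.
  rewrite (big_pred1 [tuple]) => [|t]; first by rewrite big_nil homog0.
  by rewrite tuple0; apply/esym/eqP.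
rewrite (big_tuple_cons _ (fun t => path geq h (map val t)) (fun t => \prod_(i <- t) X (val i))) /=.
rewrite homog_unfold (big_ord_widen n (fun j => X j * homog j.+1 k) (ltn_ord h)) [RHS]big_mkcond /=.
apply: eq_bigr => j _; rewrite ltnS; case: leqP => jh; last by rewrite big_pred0.
by rewrite -IH mulr_sumr; apply: eq_bigr => t _; rewrite big_cons.
Qed.

(** Reversing the tuples puts the largest index first, as in [homog]; commutation keeps the products
    the same. *)
Lemma complete_homogeneousE (x : 'I_n -> R) k : (forall i, x i = X (val i)) ->
  complete_homogeneous k x = homog n k.
Proof.
move=> xE; rewrite /complete_homogeneous.
have xC i j : GRing.comm (x i) (x j) by rewrite !xE.
have revTK : involutive (fun t : k.-tuple 'I_n => [tuple of rev t]).
  by move=> t; apply: val_inj; apply: revK.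
rewrite (reindex_inj (inv_inj revTK)) /=.
transitivity (\sum_(t : k.-tuple 'I_n | sorted geq (map val t)) \prod_(i <- t) X (val i)).
  apply: eq_big => t; first by rewrite map_rev rev_sorted.
  by move=> _; rewrite prod_rev //; apply: eq_bigr => i _; rewrite xE.
clear revTK; case: k => [|k].
  rewrite (big_pred1 [tuple]) => [|t]; first by rewrite big_nil homog0.
  by rewrite tuple0; apply/esym/eqP.
rewrite (big_tuple_cons _ (fun t => sorted geq (map val t)) (fun t => \prod_(i <- t) X (val i))) /=.
rewrite homog_unfold; apply: eq_bigr => h _; rewrite -sum_path_homog mulr_sumr.
by apply: eq_bigr => t _; rewrite big_cons.
Qed.

End Tuples.
End SymmetricFunctions.

Arguments homog : simpl never.
Arguments elem : simpl never.

(** * Odd Jucys-Murphy elements *)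

Section JucysMurphy.
Variable n : nat.
Implicit Types (s t h : {perm bpoint n}) (x y z : bpoint n) (i j : 'I_n).
Local Notation b := (barp n).
Local Notation R := (permalg (bpoint n)).

Lemma permalg_ofE t (f : R) s : (permalg_of t * f) s = f (s * t^-1)%g.
Proof.
rewrite ffunE (bigD1 t) //= ffunE eqxx mul1r big1 ?addr0 // => u /negPf ut.
by rewrite ffunE ut mul0r.
Qed.

Lemma permalg_sumE (I : Type) (r : seq I) (P : pred I) (F : I -> R) s :
  (\sum_(i <- r | P i) F i) s = \sum_(i <- r | P i) F i s.
Proof. by apply: (big_morph (fun f : R => f s)) => [f g|]; rewrite ffunE. Qed.

Lemma odd_jmE i (f : R) s :
  (odd_jm i * f) s = \sum_(y : bpoint n | (y.1 < i)%N) f (s * tperm y (i, false))%g.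
Proof.
rewrite mulr_suml permalg_sumE; apply: eq_bigr => y _.
by rewrite permalg_ofE tpermV.
Qed.

Lemma tperm_fst l x y z : (x.1 < l)%N -> (y.1 < l)%N ->
  ((tperm x y z).1 < l)%N = (z.1 < l)%N.
Proof. by move=> xl yl; case: tpermP => [->|->|//]; rewrite ?xl ?yl. Qed.

(** For [i < j], conjugation by a term of [odd_jm i] fixes [(j, false)] and permutes the points of
    index below [j], hence the terms of [odd_jm j]. *)
Lemma odd_jm_comm i j : GRing.comm (odd_jm i) (odd_jm j).
Proof.
wlog lt_ij : i j / (i < j)%N.
  move=> H; case: (ltngtP i j) => [/H //|/H /esym //|/val_inj ->]; exact: commr_refl.
apply: commr_sym; apply: commr_sum => y yi; rewrite /GRing.comm /odd_jm.
rewrite mulr_suml mulr_sumr.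
have yj : (y.1 < j)%N := ltn_trans yi lt_ij.
rewrite [RHS](reindex_inj (@perm_inj _ (tperm y (i, false)))) /=.
apply: eq_big => [z|z _]; first by rewrite tperm_fst.
rewrite !permalg_ofM; congr permalg_of.
have {2}-> : (j, false) = tperm y (i, false) (j, false).
  rewrite tpermD //; last by apply/eqP=> -[ij]; rewrite ij ltnn in lt_ij.
  by apply: contraTneq yj => ->; rewrite ltnn.
by rewrite -tpermJ /conjg tpermV -!mulgA tperm2 mulg1.
Qed.

(** Extended by 0 to all of [nat], the index type of [homog] and [elem]. *)
Definition jm (l : nat) : R := oapp (@odd_jm n) 0 (insub l).

Lemma jmE i : jm i = odd_jm i. Proof. by rewrite /jm valK. Qed.

Lemma jm_comm k l : GRing.comm (jm k) (jm l).
Proof.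
rewrite /jm; case: insubP => [i _ _|_] /=; last exact/commr_sym/commr0.
by case: insubP => [j _ _|_] /=; [apply: odd_jm_comm | apply: commr0].
Qed.

Lemma complete_homogeneous_jm k : complete_homogeneous k (@odd_jm n) = homog jm n k.
Proof. by apply: complete_homogeneousE => [|i]; [apply: jm_comm | rewrite jmE]. Qed.

Definition fixes (l : nat) s := [forall x : bpoint n, (l <= x.1)%N ==> (s x == x)].

Lemma fixesP l s : reflect (forall x, (l <= x.1)%N -> s x = x) (fixes l s).
Proof.
apply: (iffP forallP) => H x; last by apply/implyP=> /H/eqP.
by move=> lx; have /implyP/(_ lx)/eqP := H x.
Qed.

Lemma hyperP s : reflect (b ^ s = b)%g (s \in hyperoctahedral n).
Proof.
rewrite inE; apply: (iffP forallP) => [H|H x].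
  apply/permP=> x; rewrite -(permKV s x) permJ.
  by have /eqP := H (s^-1 x)%g; rewrite !barpE => ->.
by have := permJ b s x; rewrite H !barpE => ->.
Qed.

(** The copy of H_l inside S_{2n}; accordingly [hsum l] is p_l. *)
Definition hgroup l : {set {perm bpoint n}} := [set s in hyperoctahedral n | fixes l s].
Definition hsum l : R := \sum_(s in hgroup l) permalg_of s.

Lemma hgroupP l s : reflect ((b ^ s)%g = b /\ fixes l s) (s \in hgroup l).
Proof. by rewrite inE; apply: (iffP andP) => -[/hyperP]. Qed.

Lemma fixes_mul l s t : fixes l t -> fixes l (s * t)%g = fixes l s.
Proof.
move/fixesP=> ft; apply/fixesP/fixesP => fs x lx.
  by have := fs x lx; rewrite permM -{2}(ft x lx) => /perm_inj.
by rewrite permM fs ?ft.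
Qed.

Lemma fixes_tperm l x y : (x.1 < l)%N -> (y.1 < l)%N -> fixes l (tperm x y).
Proof.
move=> xl yl; apply/fixesP=> z lz; rewrite tpermD //.
  by apply: contraTneq lz => <-; rewrite -ltnNge.
by apply: contraTneq lz => <-; rewrite -ltnNge.
Qed.

Lemma fixesV l s : fixes l s -> fixes l s^-1%g.
Proof.
by move/fixesP=> fs; apply/fixesP=> x lx; rewrite -{1}(fs x lx) permK.
Qed.

Lemma fixes_all s : fixes n s.
Proof. by apply/fixesP=> x; rewrite leqNgt ltn_ord. Qed.

Lemma hsum_top : hyperoctahedral_sum n = hsum n.
Proof. by apply: eq_bigl => s; rewrite [RHS]inE fixes_all andbT. Qed.

Lemma sum_permalg_of (P : pred {perm bpoint n}) s :
  (\sum_(t | P t) permalg_of t : R) s = (P s)%:R.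
Proof.
rewrite permalg_sumE (eq_bigr (fun t => if s == t then 1 else 0)) => [|t _].
  rewrite -big_mkcondr /=; case: (boolP (P s)) => hs.
    by rewrite (big_pred1 s) // => t; rewrite /= eq_sym; case: eqP => [->|]; rewrite ?hs ?andbF.
  by rewrite big_pred0 // => t; apply/negP=> /andP[ht /eqP E]; rewrite E ht in hs.
by rewrite ffunE; case: eqP.
Qed.

Lemma hsumE l s : hsum l s = (s \in hgroup l)%:R.
Proof. exact: sum_permalg_of. Qed.

Lemma level_mul l s t : fixes l t -> level l (s * t)%g = level l s.
Proof.
suff H u v : fixes l v -> level l u -> level l (u * v)%g.
  by move=> ft; apply/idP/idP => [/(H _ _ (fixesV ft))|]; [rewrite mulgK | apply: H].
move=> fv /levelP lu; apply/levelP=> x lx; rewrite conjgM.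
have vx := fixesP _ _ fv _ lx.
by rewrite -{1}vx permJ lu // (fixesP _ _ fv) // barp1.
Qed.

Lemma level_fixes l s : fixes l s -> level l s.
Proof.
move=> fs; rewrite -[s]mul1g level_mul //.
by apply/levelP=> x _; rewrite conjg1.
Qed.

Lemma levelS l s : level l s -> level l.+1 s.
Proof. by move/levelP=> ls; apply/levelP=> x lx; apply: ls; apply: ltnW. Qed.

(** [h] is an isomorphism from the graph of [s] to that of [(s * h)%g]: it preserves solid edges and
    carries the dashed ones along. *)
Lemma half_length_mul s h x : (b ^ h)%g = b -> half_length (s * h)%g (h x) = half_length s x.
Proof.
move=> bh; rewrite /half_length /half_cycle /orb conjgM -{1}bh -conjMg.
rewrite -[RHS](card_imset _ (@perm_inj _ h)); congr #|pred_of_set _|.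
apply/setP=> y; apply/porbit_iterP/imsetP => [[k ->]|[z /porbit_iterP[k ->] ->]].
  exists (iter k (b * b ^ s)%g x); first exact: porbit_iter.
  by elim: k => //= k ->; rewrite permJ.
by exists k; elim: k => //= k <-; rewrite permJ.
Qed.

Lemma coset_type_mul s h : (b ^ h)%g = b -> coset_type (s * h)%g = coset_type s.
Proof.
move=> bh; have E : perm_eq (coset_type (s * h)%g) (coset_type s).
  apply: perm_eq_weights => [||g]; [exact: coset_type_gt0 | exact: coset_type_gt0 | ].
  apply: etrans (sum_coset_type_nat _ g) _.
  apply: etrans _ (esym (sum_coset_type_nat s g)).
  rewrite [LHS](reindex_inj (@perm_inj _ h)) /=.
  by apply: eq_bigr => x _; rewrite half_length_mul.
rewrite (coset_type_sort E) sorted_sort ?coset_type_sorted //; exact: geq_trans.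
Qed.

Lemma coset_type_half_length s p : p \in coset_type s -> exists x, half_length s x = p.
Proof.
rewrite mem_sort => /mapP[C]; rewrite mem_enum => /cycle_supportsP[x [_ cC]] ->.
by exists x; rewrite cC doubleK.
Qed.

Lemma half_length1P s x : reflect ((b ^ s)%g x = b x) (half_length s x == 1%N).
Proof.
have [MK _] := fpf_barp s.
apply: (iffP eqP) => [E|E].
  have := iter_porbit (b * b ^ s)%g x; rewrite -/(half_length s x) E /= permM.
  by move/(canRL MK).
by apply: card_porbit_iter => [//||k]; [rewrite /= permM -E MK | lia].
Qed.

Lemma level0P s : level 0 s = (size (coset_type s) == n).
Proof.
have t0 := coset_type_gt0 s.
have -> : (size (coset_type s) == n) = all (pred1 1%N) (coset_type s).
  transitivity (size (coset_type s) == sumn (coset_type s)).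
    by rewrite sumn_coset_type.
  elim: (coset_type s) t0 => //= p t IH; rewrite inE negb_or => /andP[p0 t0].
  rewrite -(IH t0); have := size_le_sumn t0; lia.
apply/levelP/allP => [ls p /coset_type_half_length[x <-]|H x _].
  exact/half_length1P/ls.
exact/half_length1P/H/half_length_mem.
Qed.

Section Top.
Variable i : 'I_n.
Let x0 : bpoint n := (i, false).

Lemma level_top s : level i.+1 s -> level i s = (half_length s x0 == 1%N).
Proof.
move=> ls; have [MK _] := fpf_barp s.
apply/levelP/half_length1P => [->//|E x]; rewrite leq_eqVlt => /orP[/eqP ix|]; last first.
  exact: (levelP _ _ ls).
have [->//|->] : x = x0 \/ x = b x0 by apply: top_point.
by rewrite -{1}E MK barpK.
Qed.

(** For the dashed edge at the top to become the solid one, [y] has to be the dashed partner of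
    [b x0]. This is the uniqueness behind [elem_hsum]. *)
Lemma level_swap_top s y : level i.+1 s -> (y.1 < i)%N ->
  level i (s * tperm y x0)%g = (y == (b * b ^ s)%g x0).
Proof.
move=> ls yi; have fM := fpf_barp s.
have ft : fixes i.+1 (tperm y x0) by rewrite fixes_tperm //= ltnS ltnW.
have lst : level i.+1 (s * tperm y x0)%g by rewrite level_mul.
rewrite level_top //; have y0 : y != x0 by apply: contraTneq yi => ->; rewrite ltnn.
have yb : y != b x0 by apply: contraTneq yi => ->; rewrite barp1 ltnn.
rewrite permM; have [MK' _] := fpf_barp (s * tperm y x0)%g.
have tE : tperm y x0 (b x0) = b x0 by rewrite tpermD // eq_sym barp_neq.
have M'E : (b ^ (s * tperm y x0))%g (b x0) = tperm y x0 ((b ^ s)%g (b x0)).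
  by rewrite -{1}tE conjgM permJ.
apply/half_length1P/eqP => E.
  by rewrite -[RHS](tpermK y x0) -M'E -E MK' tpermR.
by rewrite -[RHS]MK' M'E -E tpermL.
Qed.

End Top.
End JucysMurphy.

(** * Left invariance under the hyperoctahedral subgroups *)

Section Invariance.
Variable n : nat.
Implicit Types (s t h : {perm bpoint n}) (x y z : bpoint n) (i j : 'I_n).
Local Notation b := (barp n).
Local Notation R := (permalg (bpoint n)).
Local Notation J := (@jm n).

(** Here [y] is the first iterate of [x0], so the swap cuts off a part 1. *)
Lemma size_coset_type_swap i s : let x0 : bpoint n := (i, false) in
  let y := (b * b ^ s)%g x0 in y != x0 ->
  size (coset_type (s * tperm y x0)%g) = (size (coset_type s)).+1.
Proof.
move=> x0 y yx.
have ib : (0 < 1 < half_length s x0)%N.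
  rewrite /= ltnNge leq_eqVlt ltnS leqNgt (card_orb_gt0 _ _ x0) orbF.
  apply: contra yx => /eqP s1; have := iter_porbit (b * b ^ s)%g x0.
  by rewrite -/(half_length s x0) s1 => /eqP.
have E := perm_to_rem (half_length_mem s x0).
rewrite tpermC; apply: etrans (perm_size (coset_type_split ib E)) _.
by congr _.+1; apply: esym (perm_size E).
Qed.

(* Every matching of level [l] arises from exactly one strictly monotone
   sequence of transpositions. *)
Lemma elem_hsum L l k s : (l <= L <= n)%N ->
  (elem J l k * hsum n L) s =
  [&& fixes L s, level l s & (size (coset_type s) + k == n)%N]%:R.
Proof.
elim: l k s => [|l IH] k s /andP[lL Ln].
  rewrite elem0l level0P; case: k => [|k] /=.
    rewrite mul1r hsumE addn0 andbb -level0P; congr (nat_of_bool _)%:R.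
    apply/hgroupP/andP => -[] // => [bs fs|fs /levelP ls]; split=> //.
      by apply/levelP=> x _; rewrite bs.
    by apply/permP=> x; apply: ls.
  rewrite mul0r ffunE; case: eqP => [->|]; rewrite ?andbF //=.
  by rewrite -[X in _ == X]addn0 eqn_add2l andbF.
have lLn : (l <= L <= n)%N by rewrite ltnW.
have ln : (l < n)%N by apply: leq_trans Ln.
pose i := Ordinal ln; pose x0 : bpoint n := (i, false); pose y0 := (b * b ^ s)%g x0.
rewrite elemS mulrDl ffunE IH //.
have ft y : (y.1 < i)%N -> fixes l.+1 (tperm y x0).
  by move=> yi; rewrite fixes_tperm //= ltnS ltnW.
have ftL y : (y.1 < i)%N -> fixes L (tperm y x0).
  by move=> yi; rewrite fixes_tperm //=; apply: leq_trans lL; rewrite ltnS ltnW.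
case: (boolP (level l.+1 s)) => ls; last first.
  rewrite (negPf (contra (@levelS _ _ _) ls)) !andbF add0r.
  case: k => [|k]; first by rewrite mul0r ffunE.
  rewrite -mulrA (jmE i) odd_jmE big1 // => y yi.
  rewrite IH // (negPf (contra (@levelS _ _ _) _)) ?andbF //.
  by rewrite level_mul // ft.
rewrite (level_top (i := i)) // andTb.
have y0i : (y0.1 < i)%N = (y0 != x0).
  apply: (half_cycle_top1 (i := i) ls); apply: (porbit_iter (b * b ^ s)%g x0 1%N).
have swE y : (y.1 < i)%N -> level l (s * tperm y x0)%g = (y == y0).
  by apply: (level_swap_top (i := i)) ls.
(* If [y0] is [x0], the edges at the top already coincide and only the term without the factor [J l]
   survives; otherwise the swap of [y0] and [x0] is the only possible contribution. *)
have [y0E|y0N] := eqVneq y0 x0.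
  have -> : half_length s (i, false) == 1%N.
    by apply/eqP/card_porbit_iter => // k'; lia.
  rewrite andTb; case: k => [|k]; first by rewrite mul0r ffunE addr0.
  rewrite -mulrA (jmE i) odd_jmE big1 ?addr0 // => y yi.
  rewrite IH // swE // y0E.
  by rewrite (_ : y == x0 = false) ?andbF //; apply: contraTF yi => /eqP->; rewrite ltnn.
have sz := size_coset_type_swap y0N.
have -> : half_length s (i, false) == 1%N = false.
  apply/negP => /eqP s1; case/negP: y0N; apply/eqP.
  by have := iter_porbit (b * b ^ s)%g x0; rewrite -/(half_length s x0) s1.
rewrite andbF add0r; case: k => [|k].
  rewrite mul0r ffunE (_ : _ + 0 == n = false)%N ?andbF //.
  apply/negP=> /eqP sn; have := size_le_sumn (coset_type_gt0 (s * tperm y0 x0)%g).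
  by rewrite sumn_coset_type -/x0 -/y0 sz; lia.
rewrite -mulrA (jmE i) odd_jmE (bigD1 y0) /= ?y0i // big1 ?addr0 => [|y /andP[yi /negPf yN]].
  rewrite IH // fixes_mul ?ftL ?y0i // swE ?y0i // eqxx /=.
  apply: (congr1 (fun m => (fixes L s && (m == n))%:R)).
  exact: etrans (congr1 (addn^~ k) sz) (addSnnS _ _).
by rewrite IH // swE // yN andbF.
Qed.

Lemma hgroup_mul l s h : h \in hgroup n l -> (s * h \in hgroup n l)%g = (s \in hgroup n l).
Proof.
case/hgroupP=> bh fh; apply/hgroupP/hgroupP; rewrite fixes_mul // => -[bs fs]; split=> //.
  by apply: (@conjg_inj _ h); rewrite -conjgM bs.
by rewrite conjgM bs.
Qed.

Lemma hgroupV l h : h \in hgroup n l -> (h^-1)%g \in hgroup n l.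
Proof.
case/hgroupP=> bh fh; apply/hgroupP; split; last exact: fixesV.
by rewrite -{1}bh conjgK.
Qed.

Lemma elem_hsum_inv L k h : (L <= n)%N -> h \in hgroup n L ->
  permalg_of h * (elem J L k * hsum n L) = elem J L k * hsum n L :> R.
Proof.
move=> Ln /hgroupV /hgroupP[bh fh]; apply/ffunP=> s.
have LLn : (L <= L <= n)%N by rewrite leqnn.
rewrite permalg_ofE; apply: etrans (elem_hsum _ _ LLn) _.
apply: etrans _ (esym (elem_hsum _ _ LLn)); rewrite (fixes_mul _ fh) (level_mul _ fh).
exact: (congr1 (fun r => [&& _, _ & (size r + k == n)%N]%:R) (coset_type_mul s bh)).
Qed.

(** [v] is the average of [p * v]. The factor [N] is cancelled after evaluation at a permutation,
    where the values are rational numbers. *)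
Lemma averaged_inv N (u e p v : R) : (0 < N)%N ->
  v *+ N = p * v -> u * (e * p) = e * p -> u * (e * v) = e * v.
Proof.
move=> N0 vN uep; apply/eqP; rewrite -subr_eq0; apply/eqP/ffunP=> s.
have: (u * (e * v) - e * v) *+ N = 0.
  by rewrite mulrnBl -!mulrnAr vN [e * (_ * _)]mulrA mulrA uep subrr.
move/(congr1 (fun f : R => f s)); rewrite ffunMnE !ffunE => /eqP.
by rewrite mulrn_eq0 eqn0Ngt N0 => /eqP.
Qed.

(* [e_j v = e_j p_L v / #|H_L|] for left [H_L]-invariant [v], and [e_j p_L] is
   left [H_L]-invariant; the relation between the [e_j] and the [h_k] carries
   the invariance over to the latter. *)
Lemma homog_hsum_inv L k h : (L <= n)%N -> h \in hgroup n L ->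
  permalg_of h * (homog J L k * hsum n n) = homog J L k * hsum n n :> R.
Proof.
move=> Ln; elim/ltn_ind: k h => k IH h hL.
have hh' := hgroupV hL; case/hgroupP: (hh') => bh' fh'.
case: k IH => [|k] IH.
  rewrite homog0 mul1r; apply/ffunP=> s; rewrite permalg_ofE !hsumE.
  by rewrite hgroup_mul //; apply/hgroupP; split=> //; apply: fixes_all.
have := elem_homog (@jm_comm n) L k.+1; rewrite big_ord_recl elem0 subn0 expr0 !mul1r.
move/eqP; rewrite addr_eq0 => /eqP ->.
rewrite -sumrN mulr_suml mulr_sumr; apply: eq_bigr => j _.
rewrite lift0 subSS.
set v := homog J L (k - j) * hsum n n.
have vN : v *+ #|hgroup n L| = hsum n L * v.
  rewrite mulr_suml -sumr_const; apply: eq_bigr => g gL.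
  by rewrite IH // ltnS leq_subr.
set e := elem J L j.+1.
have E : permalg_of h * (e * v) = e * v.
  apply: averaged_inv vN (elem_hsum_inv _ Ln hL).
  by apply/card_gt0P; exists h.
rewrite -signr_odd mulNr -!mulrA -/v -/e; case: (odd _).
  by rewrite expr1 mulN1r opprK E.
by rewrite expr0 mul1r mulrN E.
Qed.

End Invariance.

(** * Coefficients depend only on the coset type *)

Section TypeDependence.
Variable n : nat.
Implicit Types (s t h : {perm bpoint n}) (x y z : bpoint n) (i j : 'I_n).
Local Notation b := (barp n).
Local Notation R := (permalg (bpoint n)).

Definition hcoef l k s : rat := (homog (@jm n) l k * hsum n n : R) s.

Lemma hcoef0 l s : hcoef l 0 s = (level 0 s)%:R.
Proof.
rewrite /hcoef homog0 mul1r hsumE; congr (nat_of_bool _)%:R.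
apply/hgroupP/levelP => [[bs _] x _|H]; first by rewrite bs.
by split; [apply/permP=> x; apply: H | apply: fixes_all].
Qed.

Lemma hcoef0l k s : hcoef 0 k.+1 s = 0.
Proof. by rewrite /hcoef homog0l mul0r ffunE. Qed.

Lemma hcoefS i k s : hcoef i.+1 k.+1 s =
  hcoef i k.+1 s + \sum_(y : bpoint n | (y.1 < i)%N) hcoef i.+1 k (s * tperm y (i, false))%g.
Proof.
rewrite /hcoef homogSS mulrDl ffunE; congr (_ + _).
by rewrite -mulrA (jmE i) odd_jmE.
Qed.

Lemma fixes_top_tperm i y : (y.1 < i)%N -> fixes i.+1 (tperm y ((i, false) : bpoint n)).
Proof. by move=> yi; rewrite fixes_tperm //= ltnS ltnW. Qed.

Lemma level0_level l s : level 0 s -> level l s.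
Proof. by move/levelP=> ls; apply/levelP=> x _; apply: ls. Qed.

(** p_n is supported on level 0, and transpositions of points of index below [l] leave the edges at
    the points of index at least [l] in place. *)
Lemma hcoef_level l k s : (l <= n)%N -> ~~ level l s -> hcoef l k s = 0.
Proof.
elim: l k s => [|l IH] k s ln ls.
  by case: k => [|k]; rewrite ?hcoef0l // hcoef0 (negPf ls).
pose i := Ordinal ln.
elim: k s ls => [|k IHk] s ls.
  by rewrite hcoef0 (negPf (contra (@level0_level _ _) ls)).
rewrite (hcoefS i) IH ?(ltnW ln) ?(contra (@levelS _ _ _) ls) //.
rewrite add0r big1 // => y yi; apply: IHk.
by rewrite (level_mul _ (fixes_top_tperm yi)).
Qed.

Lemma hcoef_inv L k s h : (L <= n)%N -> h \in hgroup n L ->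
  hcoef L k (s * h)%g = hcoef L k s.
Proof.
move=> Ln hL; rewrite /hcoef -[in RHS](homog_hsum_inv k Ln (hgroupV hL)).
by rewrite permalg_ofE invgK.
Qed.

Lemma sum_below i s (f : nat -> rat) : level i.+1 s ->
  \sum_(x : bpoint n | (x.1 <= i)%N) f (half_length s x) =
  \sum_(p <- coset_type s) f p *+ p.*2 - \sum_(x : bpoint n | (i < x.1)%N) f 1%N.
Proof.
move=> ls; apply/eqP; rewrite eq_sym subr_eq; apply/eqP.
apply: etrans (sum_coset_type f s) _.
rewrite (bigID (fun x : bpoint n => (x.1 <= i)%N)) /=; congr (_ + _).
apply: eq_big => [x|x]; rewrite -ltnNge // => xi.
by rewrite (level_half_length ls xi).
Qed.

(** Above [i] all half lengths are 1 for both permutations, so equal types give equal weighted sums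
    over the points of index at most [i]; the weight is the indicator of the wanted length. *)
Lemma below_half_length i s1 s2 x : level i.+1 s1 -> level i.+1 s2 ->
  coset_type s1 = coset_type s2 -> (x.1 <= i)%N ->
  exists2 y : bpoint n, (y.1 <= i)%N & half_length s1 y = half_length s2 x.
Proof.
move=> l1 l2 ct xi; pose f p : rat := (p == half_length s2 x)%:R.
have E : \sum_(y : bpoint n | (y.1 <= i)%N) f (half_length s1 y) =
         \sum_(y : bpoint n | (y.1 <= i)%N) f (half_length s2 y).
  by apply: etrans (sum_below f l1) _; rewrite ct; apply: esym (sum_below f l2).
have : 0 < \sum_(y : bpoint n | (y.1 <= i)%N) f (half_length s1 y).
  rewrite E (bigD1 x xi); apply: ltr_pwDl; first by rewrite /f eqxx ltr01.
  by apply: sumr_ge0 => y _; apply: ler0n.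
case: (pickP (fun y : bpoint n => (y.1 <= i)%N && (half_length s1 y == half_length s2 x))).
  by move=> y /andP[yi /eqP]; exists y.
move=> none; have -> : \sum_(y : bpoint n | (y.1 <= i)%N) f (half_length s1 y) = 0.
  by apply: big1 => y yi; have := none y; rewrite yi andTb /f => ->.
by rewrite ltxx.
Qed.

(** Exchanges two indices and keeps the bars, so as to bring a chosen cycle to the top index within
    the hyperoctahedral group. *)
Definition swap_fun i j (x : bpoint n) : bpoint n := (tperm i j x.1, x.2).

Lemma swap_funK i j : involutive (swap_fun i j).
Proof. by case=> k e; rewrite /swap_fun /= tpermK. Qed.

Definition swap i j : {perm bpoint n} := perm (inv_inj (swap_funK i j)).

Lemma swap_hgroup i j : (j <= i)%N -> swap j i \in hgroup n i.+1.
Proof.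
move=> ji; apply/hgroupP; split.
  apply/permP=> x; rewrite -{1}(swap_funK j i x) -[swap_fun j i _](permE (inv_inj (swap_funK j i))).
  by rewrite permJ !permE /swap_fun /= tpermK.
apply/fixesP=> -[k e] /= ik; rewrite permE /swap_fun /= tpermD //.
  by apply: contraTneq ik => <-; rewrite -leqNgt.
by apply: contraTneq ik => <-; rewrite ltnn.
Qed.

(** Induction on [l], then on [k]. Invariance under [hgroup] reduces to top cycles of equal length;
    then [sum_swap_top] and [sum_below_outside] express both recursions through the common type. *)
Lemma hcoef_type l k s1 s2 : (l <= n)%N -> level l s1 -> level l s2 ->
  coset_type s1 = coset_type s2 -> hcoef l k s1 = hcoef l k s2.
Proof.
have H0 l' u1 u2 : coset_type u1 = coset_type u2 -> hcoef l' 0 u1 = hcoef l' 0 u2.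
  by move=> ct; rewrite !hcoef0 !level0P ct.
elim: l k s1 s2 => [|l IH] k s1 s2 ln l1 l2 ct.
  by case: k => [|k]; [apply: H0 | rewrite !hcoef0l].
pose i := Ordinal ln; pose x0 : bpoint n := (i, false).
elim: k s1 s2 l1 l2 ct => [|k IHk] s1 s2 l1 l2 ct; first exact: H0.
wlog Em : s1 l1 ct / half_length s1 x0 = half_length s2 x0.
  move=> W; have [] := @below_half_length i s1 s2 x0 l1 l2 ct (leqnn i).
  move=> [j e] ji Ej; have hs := swap_hgroup ji; have [bh fh] := hgroupP _ _ hs.
  rewrite -(hcoef_inv _ _ ln hs); apply: W.
  - by rewrite (level_mul _ fh).
  - by rewrite -ct; apply: coset_type_mul.
  rewrite -Ej; apply: etrans _ (half_length_mul _ _ bh).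
  have -> : swap j i (j, e) = (i, e) by rewrite permE /swap_fun /= tpermL.
  (* The chosen point may be barred; it is then moved to [b x0], which has the half length of
     [x0]. *)
  have -> : (i, e) = if e then b x0 else x0 by rewrite barpE; case: (e).
  by case: (e); first exact: esym (half_length_barp _ _).
rewrite !(hcoefS i); congr (_ + _).
  have := level_top (i := i) l1; have := level_top (i := i) l2; rewrite -/x0 Em => <-.
  case: (boolP (level l s2)) => l2' l1'.
    by apply: (IH _ _ _ (ltnW ln) _ l2' ct); rewrite l1'.
  apply: etrans (hcoef_level k.+1 (ltnW ln) _) _; first by rewrite l1'.
  exact: esym (hcoef_level k.+1 (ltnW ln) l2').
(* The induction hypothesis on [k] makes the previous coefficient a function of the type, read off
   any permutation of the right level. *)
pose F r := if [pick s | level l.+1 s && (coset_type s == r)] is Some s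
            then hcoef l.+1 k s else 0.
have HF s : level l.+1 s -> hcoef l.+1 k s = F (coset_type s).
  move=> ls; rewrite /F; case: pickP => [u /andP[lu /eqP ctu]|/(_ s)].
    exact: IHk _ _ ls lu (esym ctu).
  by rewrite ls eqxx.
have FE s : level l.+1 s ->
    \sum_(y : bpoint n | (y.1 < i)%N) hcoef l.+1 k (s * tperm y x0)%g =
    \sum_(y : bpoint n | (y.1 < i)%N) F (coset_type (s * tperm y x0)%g).
  by move=> ls; apply: eq_bigr => y yi; apply: HF; rewrite (level_mul _ (fixes_top_tperm yi)).
apply: etrans (FE _ l1) _; apply: etrans _ (esym (FE _ l2)).
apply: etrans (sum_swap_top (i := i) l1 F) _.
apply: etrans _ (esym (sum_swap_top (i := i) l2 F)).
rewrite -/x0 Em ct; congr (_ + _).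
pose f p := F (sort geq (half_length s2 x0 + p :: rem p (rem (half_length s2 x0) (coset_type s2)))%N).
apply: etrans (sum_below_outside (i := i) l1 f) _.
apply: etrans _ (esym (sum_below_outside (i := i) l2 f)).
by rewrite -/x0 Em ct.
Qed.

End TypeDependence.

(** * Areas of Dyck paths *)

Section DyckPaths.
Implicit Types (w u v : seq bool) (I : seq nat).

Definition total w : int := \sum_(b <- w) (if b then 1 else -1).

Lemma total_cat u v : total (u ++ v) = total u + total v.
Proof. exact: big_cat. Qed.

Lemma total_cons b w : total (b :: w) = (if b then 1 else -1) + total w.
Proof. exact: big_cons. Qed.

Lemma total_nil : total [::] = 0. Proof. exact: big_nil. Qed.

Lemma size_total w : (size w)%:Z = total w + 2 * (count negb w)%:Z.
Proof.
elim: w => [|b w IH]; first by rewrite total_nil.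
by rewrite total_cons /=; move: IH; case: b => /=; lia.
Qed.

Lemma heightE w j : height w j = total (take j w). Proof. by []. Qed.

Lemma height_cat u v j : height (u ++ v) j =
  if (j <= size u)%N then height u j else total u + height v (j - size u).
Proof.
rewrite !heightE take_cat; case: ltngtP => [||->] //; last by rewrite subnn take0 cats0 take_size.
by rewrite total_cat.
Qed.

Lemma dyckP w : reflect (total w = 0 /\ forall j, 0 <= height w j) (is_dyck w).
Proof.
rewrite /is_dyck heightE take_size; apply: (iffP andP) => -[/eqP w0 H]; split=> //.
- move=> j; have [js|sj] := leqP j (size w).
    by have /forallP/(_ (Ordinal (js : (j < (size w).+1)%N))) := H.
  by rewrite heightE take_oversize ?w0 // ltnW.
by apply/forallP=> j.
Qed.

Lemma dyck_nil : is_dyck [::].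
Proof. by apply/dyckP; split=> [|j]; rewrite ?heightE /= total_nil. Qed.

Lemma dyck_cat u v : is_dyck u -> is_dyck v -> is_dyck (u ++ v).
Proof.
move=> /dyckP[u0 uP] /dyckP[v0 vP]; apply/dyckP; split=> [|j].
  by rewrite total_cat u0 v0.
by rewrite height_cat; case: ifP => // _; rewrite u0 add0r.
Qed.

Lemma dyck_arch u v : is_dyck u -> is_dyck v -> is_dyck (true :: u ++ false :: v).
Proof.
move=> /dyckP[u0 uP] /dyckP[v0 vP]; apply/dyckP; split=> [|[|j]].
- by rewrite total_cons total_cat total_cons u0 v0.
- by rewrite heightE take0 total_nil.
rewrite heightE /= total_cons -heightE height_cat.
case: ifP => _; first by rewrite addr_ge0.
rewrite u0 add0r; case: (j - _)%N => [|k]; first by rewrite heightE take0 total_nil.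
by rewrite heightE /= total_cons addrA subrr add0r -heightE.
Qed.

(** Dyck paths with an arbitrary starting height, the generality needed for induction on steps. *)
Definition above (h : int) w := h + total w = 0 /\ forall j, 0 <= h + height w j.

Lemma above_cons h b w : above h (b :: w) -> above (h + if b then 1 else -1) w.
Proof.
case; rewrite total_cons addrA => E P; split=> // j.
by have := P j.+1; rewrite heightE /= total_cons addrA.
Qed.

Lemma above_dyck w : above 0 w <-> is_dyck w.
Proof.
split=> [[E P]|/dyckP[E P]]; last by split; [rewrite add0r | move=> j; rewrite add0r].
by apply/dyckP; split; [rewrite add0r in E | move=> j; have := P j; rewrite add0r].
Qed.

(** The cut is at the first step below the starting height. After an up step two such cuts are
    needed, hence the induction on length. *)
Lemma first_descent (h : nat) w : above h.+1%:Z w ->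
  exists u v, [/\ w = u ++ false :: v, is_dyck u & above h%:Z v].
Proof.
have [m] := ubnP (size w); elim: m w h => // m IH [|[] w] h /=.
- by move=> _ [/eqP]; rewrite total_nil addr0.
- rewrite ltnS => sw /above_cons aw.
  have {}aw : above h.+2%:Z w by move: aw; congr above; lia.
  have [u1 [v1 [wE d1 a1]]] := IH w h.+1 sw aw.
  have sv : (size v1 < m)%N.
    by move: sw; rewrite wE size_cat /=; lia.
  have [u2 [v2 [vE d2 a2]]] := IH v1 h sv a1.
  exists (true :: u1 ++ false :: u2), v2; split=> //; last exact: dyck_arch.
  by rewrite wE vE /= -catA.
move=> _ /above_cons aw; exists [::], w; split=> //; first exact: dyck_nil.
by move: aw; congr above; lia.
Qed.

Lemma dyck_split w : is_dyck w -> w != [::] ->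
  exists u v, [/\ w = true :: u ++ false :: v, is_dyck u & is_dyck v].
Proof.
case: w => [|[] w] // /above_dyck.
  move/above_cons; rewrite add0r => /(@first_descent 0)[u [v [-> du /above_dyck dv]]] _.
  by exists u, v.
by case=> _ /(_ 1%N); rewrite heightE /= take0 total_cons total_nil.
Qed.

(** If one of [u], [u'] were longer, its prefix one step beyond the length of the other would end at
    height -1. *)
Lemma dyck_arch_inj u v u' v' : is_dyck u -> is_dyck u' ->
  u ++ false :: v = u' ++ false :: v' -> u = u' /\ v = v'.
Proof.
suff H x y x' y' : is_dyck x -> is_dyck x' -> x ++ false :: y = x' ++ false :: y' ->
    (size x' <= size x)%N.
  move=> du du' E; have su : size u = size u'.
    by apply/eqP; rewrite eqn_leq (H _ _ _ _ du' du (esym E)) (H _ _ _ _ du du' E).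
  by move/eqP: E; rewrite eqseq_cat // => /andP[/eqP-> /eqP[->]].
move=> /dyckP[x0 _] /dyckP[_ P'] E; rewrite leqNgt; apply/negP=> lt.
have := P' (size x).+1; have := congr1 (take (size x).+1) E.
rewrite take_cat ltnNge leqnSn /= subSnn /= take0 takel_cat // heightE => <-.
by rewrite total_cat x0 total_cons total_nil.
Qed.

(** Starting at height [total u] lifts [v] by a rectangle of that height and of width [size v]. *)
Lemma path_area_cat u v :
  path_area (u ++ v) = path_area u + path_area v + (total u)%:~R * (size v)%:R.
Proof.
rewrite /path_area size_cat (big_cat_nat (n := size u)) ?leq_addr //= -addrA.
congr (_ + _).
  by apply: eq_big_nat => j /= ju; rewrite !height_cat ju ltnW.
rewrite -{1}[size u]add0n big_addn addKn.
have -> : (total u)%:~R * (size v)%:R = \sum_(0 <= j < size v) (total u)%:~R :> rat.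
  by rewrite big_const_nat subn0 iter_addr_0 mulr_natr.
rewrite -big_split /=; apply: eq_big_nat => j _.
rewrite !height_cat -addSn; have -> : (j.+1 + size u <= size u)%N = false by lia.
rewrite !addnK; case: leqP => ju; last by rewrite !intrD; field.
(* At the junction [height_cat] reads the height at the end of [u]. *)
have -> : j = 0%N by lia.
by rewrite add0n !heightE take_size take0 total_nil !intrD; field.
Qed.

Lemma path_area_nil : path_area [::] = 0.
Proof. by rewrite /path_area big_geq. Qed.

Lemma path_area_seq1 b : path_area [:: b] = (if b then 1 else -1) / 2.
Proof.
rewrite /path_area big_nat1 !heightE /= total_nil total_cons total_nil add0r addr0.
by case: b.
Qed.

(** The arch lifts [u] by 1 and adds two triangles of area 1/2. *)
Lemma path_area_arch u v : is_dyck u -> is_dyck v ->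
  path_area (true :: u ++ false :: v) = path_area u + path_area v + (size u).+1%:R.
Proof.
move=> /dyckP[u0 _] /dyckP[v0 _].
rewrite -cat1s path_area_cat path_area_cat u0 -[false :: v]cat1s path_area_cat.
rewrite !path_area_seq1 !total_cons !total_nil !size_cat /= !addr0 intrN.
by rewrite -[(size u).+1]addn1 !natrD; field.
Qed.

Lemma path_area_cat_dyck u v : is_dyck u ->
  path_area (u ++ v) = path_area u + path_area v.
Proof. by move=> /dyckP[u0 _]; rewrite path_area_cat u0 mul0r addr0. Qed.

(** * Dyck paths counted by first return *)

Definition dyck_words (k : nat) : seq (seq bool) :=
  [seq tval t | t in [pred t : (2 * k).-tuple bool | is_dyck t]].

Lemma dyck_wordsP k w : reflect (size w = (2 * k)%N /\ is_dyck w) (w \in dyck_words k).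
Proof.
apply: (iffP mapP) => [[t]|[sw dw]].
  by rewrite mem_enum => dt ->; rewrite size_tuple.
exists (tcast sw (in_tuple w)); last by rewrite val_tcast.
by rewrite mem_enum inE val_tcast.
Qed.

Lemma dyck_words_uniq k : uniq (dyck_words k).
Proof. by rewrite map_inj_uniq ?enum_uniq //; apply: val_inj. Qed.

Definition dyck_arches (a c : nat) : seq (seq bool) :=
  [seq true :: u ++ false :: v | u <- dyck_words a, v <- dyck_words c].

Lemma dyck_archesP a c w : reflect
  (exists u v, [/\ u \in dyck_words a, v \in dyck_words c & w = true :: u ++ false :: v])
  (w \in dyck_arches a c).
Proof. exact: allpairsPdep. Qed.

(** Decomposition at the first return to the axis; [2 * a] is the length of the path under the first
    arch. *)
Lemma dyck_words_rec k :
  perm_eq (dyck_words k.+1) [seq w | a <- iota 0 k.+1, w <- dyck_arches a (k - a)].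
Proof.
apply: uniq_perm; first exact: dyck_words_uniq.
  apply: allpairs_uniq_dep => [|a _|]; first exact: iota_uniq.
    apply: allpairs_uniq => [||[u v] [u' v']]; try exact: dyck_words_uniq.
    move=> /allpairsP[[x y] [/= /dyck_wordsP[_ dx] _ [? ?]]]; subst u v.
    move=> /allpairsP[[x' y'] [/= /dyck_wordsP[_ dx'] _ [? ?]]] [E]; subst u' v'.
    by have [-> ->] := dyck_arch_inj dx dx' E.
  move=> p p' /allpairsPdep[a [w [_ /dyck_archesP[u [v [/dyck_wordsP[su du] _ wE]]] ->]]].
  move=> /allpairsPdep[a' [w' [_ /dyck_archesP[u' [v' [/dyck_wordsP[su' du'] _ wE']]] ->]]] /= ww.
  have aa : a = a'.
    move: ww; rewrite wE wE' => -[E]; have [uu _] := dyck_arch_inj du du' E.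
    by move: su su'; rewrite uu; lia.
  by rewrite aa ww.
move=> w; apply/dyck_wordsP/allpairsPdep.
  move=> [sw dw]; have [|u [v [wE du dv]]] := dyck_split dw.
    by apply/eqP=> w0; rewrite w0 /= in sw; lia.
  have Eu := odd_double_half (size u).
  (* Evenness makes the witness [(size u)./2] exact. *)
  have even_size x : is_dyck x -> ~~ odd (size x).
    by case/dyckP=> x0 _; have := size_total x; rewrite x0; lia.
  have := even_size u du; have := even_size v dv; have Ev := odd_double_half (size v).
  move=> ov ou; rewrite wE /= size_cat /= in sw.
  exists (size u)./2, w; split=> //; first by rewrite mem_iota; lia.
  by apply/dyck_archesP; exists u, v; split=> //; apply/dyck_wordsP; split=> //; lia.
move=> [a [x [ak /dyck_archesP[u [v [/dyck_wordsP[su du] /dyck_wordsP[sv dv] ->]]] ->]]].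
rewrite mem_iota in ak; split; last exact: dyck_arch.
by rewrite /= size_cat /= su sv; lia.
Qed.

Lemma sum_dyck_words_rec (F : seq bool -> rat) k :
  \sum_(w <- dyck_words k.+1) F w = \sum_(a < k.+1)
    \sum_(u <- dyck_words a) \sum_(v <- dyck_words (k - a)) F (true :: u ++ false :: v).
Proof.
rewrite (perm_big _ (dyck_words_rec k)) big_allpairs_dep.
rewrite -[iota 0 k.+1]/(index_iota 0 k.+1) big_mkord; apply: eq_bigr => a _.
by rewrite /dyck_arches big_allpairs_dep.
Qed.

(** Taken in [rat] so that one can divide by it. *)
Definition catalan k : rat := (size (dyck_words k))%:R.
Definition dyck_area k : rat := \sum_(w <- dyck_words k) path_area w.

Lemma sum_catalan k : \sum_(w <- dyck_words k) 1 = catalan k.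
Proof. by rewrite big_const_seq count_predT iter_addr_0. Qed.

Lemma dyck_words0 : perm_eq (dyck_words 0) [:: [::]].
Proof.
apply: uniq_perm; rewrite ?dyck_words_uniq // => w; rewrite inE.
by apply/dyck_wordsP/eqP => [[/size0nil ->]|->] //; split=> //; apply: dyck_nil.
Qed.

Lemma catalan0 : catalan 0 = 1.
Proof. by rewrite -sum_catalan (perm_big _ dyck_words0) big_seq1. Qed.

Lemma dyck_area0 : dyck_area 0 = 0.
Proof. by rewrite /dyck_area (perm_big _ dyck_words0) big_seq1 path_area_nil. Qed.

Lemma catalan_rec k : catalan k.+1 = \sum_(a < k.+1) catalan a * catalan (k - a).
Proof.
rewrite -sum_catalan sum_dyck_words_rec; apply: eq_bigr => a _.
by rewrite -(sum_catalan a) mulr_suml; apply: eq_bigr => u _; rewrite mul1r sum_catalan.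
Qed.

Lemma catalan_gt0 k : 0 < catalan k.
Proof.
elim/ltn_ind: k => -[|k] IH; first by rewrite catalan0.
rewrite catalan_rec big_ord_recl; apply: ltr_pwDl.
  by rewrite mulr_gt0 ?IH // subn0.
by apply: sumr_ge0 => a _; rewrite ltW // mulr_gt0 ?IH // ltnS ?leq_subr.
Qed.

(* The reflection [a -> k - a] turns the weight [2 a + 1], the area of the
   strip under the first arch, into its mean [k + 1]. *)
Lemma dyck_area_rec k : dyck_area k.+1 =
  \sum_(a < k.+1) (dyck_area a * catalan (k - a) + catalan a * dyck_area (k - a)) +
  k.+1%:R * catalan k.+1.
Proof.
pose c (a : 'I_k.+1) := catalan a * catalan (k - a).
transitivity (\sum_(a < k.+1) (dyck_area a * catalan (k - a) + catalan a * dyck_area (k - a)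
   + (2 * a).+1%:R * c a)).
  rewrite /dyck_area sum_dyck_words_rec; apply: eq_bigr => a _.
  transitivity (\sum_(u <- dyck_words a) \sum_(v <- dyck_words (k - a))
     (path_area u + path_area v + (2 * a).+1%:R)).
    apply: eq_big_seq => u /dyck_wordsP[su du]; apply: eq_big_seq => v /dyck_wordsP[_ dv].
    by rewrite path_area_arch // su.
  transitivity (\sum_(u <- dyck_words a)
     (path_area u * catalan (k - a) + dyck_area (k - a) + (2 * a).+1%:R * catalan (k - a))).
    apply: eq_bigr => u _; rewrite !big_split /= -/(dyck_area _); congr (_ + _ + _).
      by rewrite -sum_catalan mulr_sumr; apply: eq_bigr => v _; rewrite mulr1.
    by rewrite -sum_catalan mulr_sumr; apply: eq_bigr => v _; rewrite mulr1.
  rewrite !big_split /= mulr_suml; congr (_ + _ + _).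
    by rewrite -sum_catalan mulr_suml; apply: eq_bigr => u _; rewrite mul1r.
  rewrite /c mulrCA -(sum_catalan a) mulr_suml.
  by apply: eq_bigr => u _; rewrite mul1r.
rewrite big_split /=; congr (_ + _).
have cR : \sum_(a < k.+1) (2 * a).+1%:R * c a = \sum_(a < k.+1) (2 * (k - a)).+1%:R * c a.
  rewrite (reindex_inj rev_ord_inj) /=; apply: eq_bigr => a _.
  have ak : (a <= k)%N by rewrite -ltnS.
  by rewrite /c /= subSS subKn // [catalan (k - a) * _]mulrC.
have : (\sum_(a < k.+1) (2 * a).+1%:R * c a) *+ 2 = (k.+1%:R * catalan k.+1) *+ 2.
  rewrite !mulr2n {1}cR -big_split catalan_rec /= mulr_sumr -big_split /=.
  apply: eq_bigr => a _; have ak : (a <= k)%N by rewrite -ltnS.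
  rewrite -/(c a) -!mulrDl -!natrD; congr (_%:R * _); lia.
by move/eqP; rewrite -subr_eq0 -mulrnBl mulrn_eq0 /= subr_eq0 => /eqP.
Qed.

(** * Concatenations of Dyck paths *)

Definition touching_words I : seq (seq bool) :=
  [seq tval t | t in touching_dyck_paths I].

Lemma touching_wordsP I w : reflect
  [/\ size w = (2 * sumn I)%N, is_dyck w & forall r, height w (2 * sumn (take r I)) = 0]
  (w \in touching_words I).
Proof.
apply: (iffP mapP) => [[t]|[sw dw hw]].
  rewrite mem_enum inE => /andP[dt /forallP ht] ->; rewrite size_tuple; split=> // r.
  have [rI|Ir] := leqP r (size I); first exact/eqP/(ht (Ordinal (rI : (r < (size I).+1)%N))).
  by have /eqP := ht ord_max; rewrite /= take_size take_oversize ?(ltnW Ir).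
exists (tcast sw (in_tuple w)); last by rewrite val_tcast.
rewrite mem_enum inE val_tcast dw; apply/forallP=> r; exact/eqP.
Qed.

Lemma touching_words_uniq I : uniq (touching_words I).
Proof. by rewrite map_inj_uniq ?enum_uniq //; apply: val_inj. Qed.

Lemma touching_words_cons i I : perm_eq (touching_words (i :: I))
  [seq u ++ v | u <- dyck_words i, v <- touching_words I].
Proof.
apply: uniq_perm; first exact: touching_words_uniq.
  apply: allpairs_uniq; rewrite ?dyck_words_uniq ?touching_words_uniq // => -[u v] [u' v'].
  move=> /allpairsP[[x y] [/= /dyck_wordsP[sx _] _ [? ?]]]; subst u v.
  move=> /allpairsP[[x' y'] [/= /dyck_wordsP[sx' _] _ [? ?]]] /= /eqP; subst u' v'.
  by rewrite eqseq_cat ?sx ?sx' // => /andP[/eqP-> /eqP->].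
move=> w; apply/touching_wordsP/allpairsPdep.
  move=> [/= sw /dyckP[w0 wP] hw]; have iw : (2 * i <= size w)%N by rewrite sw; lia.
  have su : size (take (2 * i) w) = (2 * i)%N by rewrite size_takel.
  have u0 : total (take (2 * i) w) = 0 by have := hw 1%N; rewrite /= take0 addn0.
  have hv j : height (drop (2 * i) w) j = height w (2 * i + j).
    rewrite -{2}(cat_take_drop (2 * i) w) height_cat su u0 add0r.
    case: leqP => [|_]; last by rewrite addKn.
    rewrite -{2}[(2 * i)%N]addn0 leq_add2l leqn0 => /eqP ->.
    by rewrite heightE take0 total_nil addn0 heightE -{1}su take_size.
  exists (take (2 * i) w), (drop (2 * i) w); split; last by rewrite cat_take_drop.
    apply/dyck_wordsP; split=> //; apply/dyckP; split=> // j.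
    by rewrite heightE -take_min; apply: wP.
  apply/touching_wordsP; split=> [||r].
  - by rewrite size_drop sw; lia.
  - apply/dyckP; split=> [|j]; last by rewrite hv.
    by have := w0; rewrite -{1}(cat_take_drop (2 * i) w) total_cat u0 add0r.
  by rewrite hv; have := hw r.+1; rewrite /= mulnDr.
move=> [u [v [/dyck_wordsP[su du] /touching_wordsP[sv dv hv] ->]]]; split=> [||r].
- by rewrite size_cat su sv /= mulnDr.
- exact: dyck_cat.
have /dyckP[u0 _] := du.
case: r => [|r]; first by rewrite /= heightE take0 total_nil.
rewrite height_cat su /= mulnDr u0 add0r addKn hv; case: leqP => // le.
have -> : (2 * i + 2 * sumn (take r I))%N = size u by rewrite su; lia.
by rewrite heightE take_size.
Qed.

Lemma touching_words_nil : perm_eq (touching_words [::]) [:: [::]].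
Proof.
apply: uniq_perm; rewrite ?touching_words_uniq // => w; rewrite inE.
apply/touching_wordsP/eqP => [[/size0nil //]|->]; split=> //; first exact: dyck_nil.
by move=> r; rewrite heightE /= total_nil.
Qed.

Lemma size_touching_words I :
  (size (touching_words I))%:R = \prod_(i <- I) catalan i.
Proof.
elim: I => [|i I IH]; first by rewrite (perm_size touching_words_nil) big_nil.
by rewrite (perm_size (touching_words_cons i I)) size_allpairs natrM IH big_cons.
Qed.

(** Area is additive under concatenation, so the area of each block is counted once for every choice
    of the other blocks; the quotient removes its own Catalan factor. *)
Lemma dyck_area_sumE I : dyck_area_sum I =
  (\prod_(i <- I) catalan i) * \sum_(i <- I) dyck_area i / catalan i.
Proof.
rewrite /dyck_area_sum -(big_image _ _ _ _ path_area) -/(touching_words I).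
elim: I => [|i I IH].
  by rewrite (perm_big _ touching_words_nil) big_seq1 path_area_nil !big_nil mulr0.
rewrite (perm_big _ (touching_words_cons i I)) big_allpairs_dep !big_cons.
transitivity (\sum_(u <- dyck_words i) (path_area u * \prod_(j <- I) catalan j +
                (\prod_(j <- I) catalan j) * \sum_(j <- I) dyck_area j / catalan j)).
  apply: eq_big_seq => u /dyck_wordsP[_ du]; rewrite -IH -size_touching_words.
  under eq_bigr do rewrite path_area_cat_dyck //.
  rewrite big_split /= big_const_seq count_predT iter_addr_0; congr (_ + _).
  exact: esym (mulr_natr _ _).
rewrite big_split /= -mulr_suml -/(dyck_area i) big_const_seq count_predT iter_addr_0.
have := catalan_gt0 i; rewrite -mulr_natl -/(catalan i).
move: (\prod_(j <- I) _) (\sum_(j <- I) _) (dyck_area i) (catalan i) => p q a c c0.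
by field; apply: lt0r_neq0.
Qed.

End DyckPaths.

(** * Catalan and area weights of a partition *)

Section LeadingValues.
Implicit Types (r t : seq nat).

Definition catalan_prod r : rat := \prod_(p <- r) catalan p.-1.
(** The area sum of the parts lowered by 1, in the form of [dyck_area_sumE]. *)
Definition area_weight r : rat :=
  catalan_prod r * \sum_(p <- r) dyck_area p.-1 / catalan p.-1.

Lemma catalan_prod_cons p r : catalan_prod (p :: r) = catalan p.-1 * catalan_prod r.
Proof. exact: big_cons. Qed.

Lemma area_weight_cons p r : area_weight (p :: r) =
  dyck_area p.-1 * catalan_prod r + catalan p.-1 * area_weight r.
Proof.
rewrite /area_weight catalan_prod_cons big_cons; have := catalan_gt0 p.-1.
move: (catalan_prod r) (\sum_(j <- r) _) (dyck_area _) (catalan _) => P q a c c0.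
by field; apply: lt0r_neq0.
Qed.

Lemma catalan_prod_rec m t : catalan_prod (m.+2 :: t) =
  \sum_(a < m.+1) catalan_prod [:: a.+1, (m - a).+1 & t].
Proof.
rewrite catalan_prod_cons catalan_rec mulr_suml; apply: eq_bigr => a _.
by rewrite !catalan_prod_cons mulrA.
Qed.

(** The sum corresponds to the cuts of a cycle with part [m.+2]. The last term, the area under the
    first arch in [dyck_area_rec], has for factor the number [m.+1] of transpositions that keep the
    type. *)
Lemma area_weight_rec m t : area_weight (m.+2 :: t) =
  \sum_(a < m.+1) area_weight [:: a.+1, (m - a).+1 & t] +
  catalan_prod (m.+2 :: t) *+ m.+1.
Proof.
rewrite area_weight_cons catalan_prod_cons /= dyck_area_rec.
transitivity (\sum_(a < m.+1) (dyck_area a * catalan (m - a) + catalan a * dyck_area (m - a))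
    * catalan_prod t + catalan m.+1 * area_weight t + catalan m.+1 * catalan_prod t *+ m.+1).
  by rewrite -mulr_suml -mulr_natl; ring.
congr (_ + _); rewrite catalan_rec mulr_suml -big_split; apply: eq_bigr => a _ /=.
by rewrite !area_weight_cons !catalan_prod_cons /=; ring.
Qed.

(* Only meaningful for [k + size r <= n + 1]. *)
Definition leading (n k : nat) r : rat :=
  if (k + size r < n)%N then 0
  else if (k + size r == n)%N then catalan_prod r else area_weight r.

Lemma leading_perm n k r t : perm_eq r t -> leading n k r = leading n k t.
Proof.
move=> rt; rewrite /leading /area_weight /catalan_prod (perm_size rt).
by rewrite (perm_big _ rt) [X in _ * X](perm_big _ rt).
Qed.

Lemma leading_sort n k r : leading n k (sort geq r) = leading n k r.
Proof. by apply: leading_perm; rewrite perm_sort. Qed.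

(** A cut makes up for the lost factor by a new part, while an unchanged type lowers [k] plus the
    number of parts by one. So the last term is 0 in the Catalan case and a Catalan product in the
    area case. *)
Lemma leading_rec n k m t : (k + size t < n)%N ->
  leading n k.+1 (m.+2 :: t) =
  \sum_(1 <= j < m.+2) leading n k [:: j, (m.+2 - j)%N & t] + leading n k (m.+2 :: t) *+ m.+1.
Proof.
move=> kt; rewrite (big_addn 0 _ 1) /= subn1 /= big_mkord.
have sE (G : nat -> nat -> rat) : \sum_(a < m.+1) G (a + 1)%N (m.+2 - (a + 1))%N =
    \sum_(a < m.+1) G a.+1 (m - a).+1.
  apply: eq_bigr => a _; have := ltn_ord a; rewrite ltnS => am.
  by rewrite addn1 subSS subSn.
rewrite (sE (fun x y => leading n k [:: x, y & t])) /leading /=.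
rewrite !addSnnS !addnS; case: ltngtP => h1.
- by rewrite big1 // add0r mul0rn.
- by rewrite (_ : (k + size t).+1 == n) ?area_weight_rec //; apply/eqP; lia.
- by rewrite mul0rn addr0 catalan_prod_rec.
Qed.

Lemma catalan_prod_ones r : all (pred1 1%N) r -> catalan_prod r = 1.
Proof.
move/allP=> r1; apply: big1_seq => p /andP[_ /r1 /eqP ->]; exact: catalan0.
Qed.

Lemma area_weight_ones r : all (pred1 1%N) r -> area_weight r = 0.
Proof.
move/allP=> r1; rewrite /area_weight big1_seq ?mulr0 // => p /andP[_ /r1 /eqP ->].
by rewrite dyck_area0 mul0r.
Qed.

End LeadingValues.

(** * Evaluation of the coefficients up to the first excess degree *)

Section Values.
Variable n : nat.
Implicit Types (s : {perm bpoint n}) (x y : bpoint n) (i : 'I_n).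

Lemma level0_ones s : level 0 s -> all (pred1 1%N) (coset_type s).
Proof.
move/levelP=> ls; apply/allP=> p /coset_type_half_length[x <-].
exact/half_length1P/ls.
Qed.

Lemma size_coset_type s : (size (coset_type s) <= n)%N.
Proof. by have := size_le_sumn (coset_type_gt0 s); rewrite sumn_coset_type. Qed.

(** A cut adds one part, a twist none, and a join removes one. This keeps the bound in
    [hcoef_leading] through the recursion. *)
Lemma size_coset_type_swap_le s x y :
  (size (coset_type (s * tperm x y)%g) <= (size (coset_type s)).+1)%N.
Proof.
have E := perm_to_rem (half_length_mem s x).
have [yx|yx] := boolP (y \in half_cycle s x).
  have [k km yE] := porbit_iter_lt yx; case: k km yE => [|k] km yE.
    have -> : (s * tperm x y)%g = s by rewrite yE /= tperm1 mulg1.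
    exact: leqnSn.
  subst y; have ib : (0 < k.+1 < half_length s x)%N by exact: km.
  apply: eq_leq; apply: etrans (perm_size (coset_type_split ib E)) _.
  by congr _.+1; apply: esym (perm_size E).
have [ybx|ybx] := boolP (y \in half_cycle s (barp n x)).
  by apply: leq_trans (eq_leq (congr1 size (coset_type_twist ybx))) (leqnSn _).
have yo : outside s x y by rewrite /outside /= inE negb_or yx.
have E2 := perm_to_rem (half_length_outside yo).
set t := rem _ (rem _ _) in E2.
have E3 : perm_eq (coset_type s) [:: half_length s x, half_length s y & t].
  by apply: perm_trans E _; rewrite perm_cons.
apply: leq_trans (eq_leq (perm_size (coset_type_join yo E3))) _.
apply: leq_trans _ (leqnSn _); apply: leq_trans _ (eq_leq (esym (perm_size E3))).
exact: (leqnSn (size t).+1).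
Qed.

Lemma hcoef_leading0 l s : hcoef l 0 s = leading n 0 (coset_type s).
Proof.
rewrite hcoef0 /leading add0n level0P; have := size_coset_type s.
case: ltngtP => // sn _.
by rewrite catalan_prod_ones // level0_ones // level0P sn.
Qed.

(** The recursion of [hcoef], with the joins dropped, is [leading_rec]. *)
Lemma hcoef_leading l k s : (l <= n)%N -> level l s ->
  (k + size (coset_type s) <= n.+1)%N -> hcoef l k s = leading n k (coset_type s).
Proof.
elim: l k s => [|l IH] k s ln ls.
  case: k => [|k] ks; first exact: hcoef_leading0.
  have o := level0_ones ls; have := ls; rewrite level0P => /eqP sn.
  (* All [n] parts are 1 and the degree is positive, so [leading] is the area weight of ones, which
     is 0. *)
  rewrite hcoef0l /leading sn; do 2![rewrite ifF; last by lia].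
  by rewrite area_weight_ones.
pose i := Ordinal ln; pose x0 : bpoint n := (i, false).
elim: k s ls => [|k IHk] s ls ks; first exact: hcoef_leading0.
pose m := half_length s x0; pose t := rem m (coset_type s).
have E : perm_eq (coset_type s) (m :: t) := perm_to_rem (half_length_mem s x0).
have sE : size (coset_type s) = (size t).+1 := perm_size E.
have kt : (k + size t < n)%N by rewrite sE in ks; lia.
rewrite (hcoefS i).
have -> : \sum_(y : bpoint n | (y.1 < i)%N) hcoef i.+1 k (s * tperm y (i, false))%g =
    \sum_(y : bpoint n | (y.1 < i)%N) leading n k (coset_type (s * tperm y x0)%g).
  apply: eq_bigr => y yi; apply: IHk.
    by rewrite (level_mul _ (fixes_top_tperm yi)).
  have := size_coset_type_swap_le s x0 y; rewrite [tperm x0 y]tpermC => h.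
  apply: leq_trans (leq_add (leqnn k) h) _; rewrite addnS; exact: ks.
rewrite (sum_swap_top (i := i) ls (leading n k)) -/x0 -/m -/t.
(* A join leaves [size t] parts, and [k + size t < n] puts it in the vanishing range. *)
have -> : \sum_(y : bpoint n | (y.1 < i)%N && outside s x0 y)
    leading n k (sort geq (m + half_length s y :: rem (half_length s y) t)%N) = 0.
  apply: big1 => y /andP[_ yo]; rewrite leading_sort /leading.
  have := perm_size (perm_to_rem (half_length_outside yo)).
  by rewrite -/m -/t /= => <-; rewrite kt.
rewrite addr0 (leading_perm _ _ E) [in RHS](leading_perm _ _ E).
have -> : \sum_(1 <= j < m) leading n k (sort geq [:: j, (m - j)%N & t]) =
    \sum_(1 <= j < m) leading n k [:: j, (m - j)%N & t].
  by apply: eq_bigr => j _; apply: leading_sort.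
have lE := level_top (i := i) ls; rewrite -/x0 -/m in lE.
have m0 : (0 < m)%N := card_orb_gt0 _ _ x0.
(* For [m = 1] there are no cuts, and the induction on [l] applies. For larger [m] the level is not
   below [i.+1], so the term of row [l] vanishes. *)
case Em : m m0 lE => [//|[|m']] _ lE.
  rewrite IH ?(ltnW ln) ?lE // big_geq // mulr0n !addr0.
  by rewrite (leading_perm _ _ E) Em.
rewrite (hcoef_level _ (ltnW ln)) ?add0r; last by rewrite (lE : level l s = _).
by rewrite leading_rec.
Qed.

End Values.

(** * The coefficients [b] *)

Section Coefficients.
Variable n : nat.
Implicit Types (s : {perm bpoint n}) (x y : bpoint n) (i : 'I_n) (mu : intpartn n).

Definition realized (r : seq nat) := exists s, perm_eq (coset_type s) r.

Lemma realized_perm r t : perm_eq r t -> realized r -> realized t.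
Proof. by move=> rt [s sr]; exists s; apply: perm_trans rt. Qed.

(** A transposition joins a cycle of half length [p] to one of half length [q]; the latter is found
    by the indicator weight of [q]. *)
Lemma realized_merge p q t : realized [:: p, q & t] -> realized (p + q :: t)%N.
Proof.
move=> [s E]; have : p \in coset_type s by rewrite (perm_mem E) inE eqxx.
case/coset_type_half_length=> x xp.
have Er : perm_eq (rem (half_length s x) (coset_type s)) (q :: t).
  rewrite xp -(perm_cons p); apply: perm_trans _ E; rewrite perm_sym.
  by apply: perm_to_rem; rewrite -xp half_length_mem.
have q0 : q != 0%N.
  apply: contraNneq (coset_type_gt0 s) => q0.
  by rewrite (perm_mem E) q0 !inE eqxx orbT.
pose f r : rat := (r == q)%:R.
have [y /andP[yo /eqP yq]|none] := pickP (fun y => outside s x y && (half_length s y == q)).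
  exists (s * tperm x y)%g; rewrite -xp -yq; apply: coset_type_join => //.
  by rewrite xp yq.
have := sum_outside f s x; rewrite big1 => [|y yo]; last first.
  by have := none y; move: yo => /= -> /=; rewrite /f => ->.
have -> : \sum_(r <- rem (half_length s x) (coset_type s)) f r *+ r.*2 =
          \sum_(r <- q :: t) f r *+ r.*2 by exact: perm_big.
rewrite big_cons /f eqxx => /esym/eqP; rewrite paddr_eq0 ?mulrn_wge0 ?ler01 //.
  by rewrite pnatr_eq0 double_eq0 (negPf q0).
by apply: sumr_ge0 => r _; rewrite mulrn_wge0 // ler0n.
Qed.

Lemma realized_ones p t : realized (nseq p.+1 1%N ++ t) -> realized (p.+1 :: t).
Proof.
elim: p t => // p IH t H; rewrite -[p.+2]addn1.
apply: realized_merge; apply: IH; apply: realized_perm H.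
by rewrite -[p.+2]addn1 nseqD -catA.
Qed.

Lemma realized_all r t : 0%N \notin r -> realized (nseq (sumn r) 1%N ++ t) -> realized (r ++ t).
Proof.
elim: r t => //= p r IH t; rewrite inE negb_or eq_sym => /andP[p0 r0].
case: p p0 => // p _ H; apply: realized_ones.
have H' : realized (nseq p.+1 1%N ++ (r ++ t)).
  apply: (@realized_perm (r ++ (nseq p.+1 1%N ++ t))); first by rewrite perm_catCA.
  apply: IH => //; apply: realized_perm H.
  by rewrite addnC nseqD -catA.
exact: H'.
Qed.

(** The identity has all parts 1, and these are joined group by group into the parts of [mu]. *)
Lemma realized_intpartn mu : exists s, coset_type s = mu.
Proof.
have /and3P[ms m0 /eqP mn] := partvalP mu.
have [|s sm] := @realized_all mu [::] m0.
  exists 1%g; rewrite cats0 mn.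
  have o : all (pred1 1%N) (coset_type (1%g : {perm bpoint n})).
    by apply: level0_ones; apply/levelP=> x _; rewrite conjg1.
  have := sumn_coset_type (1%g : {perm bpoint n}).
  by move/all_pred1P: o => ->; rewrite sumn_nseq mul1n => ->.
exists s; rewrite (coset_type_sort sm) cats0 sorted_sort //; exact: geq_trans.
Qed.

Lemma coset_classE mu s : coset_class mu s = (coset_type s == mu)%:R.
Proof.
exact: (sum_permalg_of (fun t => coset_type t == mu)).
Qed.

Lemma coset_class_sumE (G : intpartn n -> rat) mu s : coset_type s = mu ->
  (\sum_(p < #|{: intpartn n}|) G (enum_val p) *: (coset_class_family n)`_p) s = G mu.
Proof.
move=> sm; rewrite permalg_sumE (bigD1 (enum_rank mu)) //= big1 => [|p pm].
  by rewrite addr0 ffunE nth_mktuple coset_classE enum_rankK sm eqxx [LHS]mulr1.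
rewrite ffunE nth_mktuple coset_classE sm (_ : _ == _ = false) ?[LHS]mulr0 //.
by apply: contraNF pm => /eqP/val_inj->; rewrite enum_valK.
Qed.

(** Evaluation at a permutation of a given type isolates one coefficient; such a permutation exists
    by [realized_intpartn]. *)
Lemma coset_class_free : free (coset_class_family n).
Proof.
apply/freeP=> k k0 p; have [s sp] := realized_intpartn (enum_val p).
pose G mu := k (enum_rank mu).
have := coset_class_sumE G sp; rewrite {2}/G enum_valK => <-.
rewrite (eq_bigr (fun p => k p *: (coset_class_family n)`_p)) ?k0 ?ffunE //.
by move=> q _; rewrite /G enum_valK.
Qed.

(** By [hcoef_type] the element is constant on types, hence a combination of coset classes; freeness
    identifies its coordinates with its values. *)
Lemma bcoefE k mu s : coset_type s = mu -> bcoef k mu = hcoef n k s.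
Proof.
move=> sm; pose v : permalg (bpoint n) := homog (@jm n) n k * hsum n n.
pose G nu := if [pick u : {perm bpoint n} | coset_type u == nu :> seq nat] is Some u
  then v u else 0.
have vG u nu : coset_type u = nu -> v u = G nu.
  move=> un; rewrite /G; case: pickP => [u' /eqP un'|/(_ u)]; last by rewrite un eqxx.
  have top (w : {perm bpoint n}) : level n w by apply: level_fixes; apply: fixes_all.
  exact: hcoef_type (leqnn n) (top u) (top u') (etrans un (esym un')).
have vE : v = \sum_(p < #|{: intpartn n}|) G (enum_val p) *: (coset_class_family n)`_p.
  apply/ffunP=> u; pose nu := IntPartn (coset_type_partition u).
  by rewrite (@coset_class_sumE G nu u) // (vG u nu).
rewrite /bcoef complete_homogeneous_jm hsum_top -/v vE coord_sum_free ?coset_class_free //.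
by rewrite enum_rankK -(vG s).
Qed.

End Coefficients.

Local Close Scope ring_scope.

Theorem theorem3p13 (n : nat) (mu : intpartn n) :
  bcoef (n - size mu + 1) mu = dyck_area_sum [seq m.-1 | m <- mu].
Proof.
have [s sm] := realized_intpartn mu.
have top : level n s by apply: level_fixes; apply: fixes_all.
(* Makes the truncated subtraction [n - size mu] exact. *)
have sn : (size mu <= n)%N by rewrite -sm size_coset_type.
rewrite (bcoefE _ sm) hcoef_leading //; last by rewrite sm; lia.
(* The degree plus the number of parts is [n + 1], which selects the area weight. *)
rewrite sm /leading; do 2![rewrite ifF; last by lia].
by rewrite dyck_area_sumE !big_map.
Qed.
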